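(* Let $k$ be a field and $R=k[[x,y]]/(xy)$. Then the global spectrum of $R$ is $\operatorname{gs}(R)=\{1,2,3\}$.
   Context: For a commutative Cohen--Macaulay ring $R$, the global spectrum $\operatorname{gs}(R)$ is the set of all finite values of $\operatorname{gldim} \operatorname{End}_R(M)$, where $M$ ranges over (nonzero) maximal Cohen--Macaulay $R$-modules; maximal Cohen--Macaulay modules are not required to have full support. *)

(* Defs.v *)
From HB Require Import structures.
From mathcomp Require Import all_boot all_order all_algebra ring_quotient.
From mathcomp Require Import boolp classical_sets.

Set Implicit Arguments.
Unset Strict Implicit.
Unset Printing Implicit Defensive.
Import GRing.Theory.
Local Open Scope ring_scope.

(* Elements of k[[x,y]]; [coef f i j] is the coefficient of x^i y^j. *)

Record series2 (k : Type) := Series2 { coef : nat -> nat -> k }.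

HB.instance Definition _ (k : Type) := gen_eqMixin (series2 k).
HB.instance Definition _ (k : Type) := gen_choiceMixin (series2 k).

Lemma series2P (k : Type) (f g : series2 k) :
  (forall i j, coef f i j = coef g i j) -> f = g.
Proof.
case: f g => [f] [g] /= fg; congr Series2.
by apply/funext => i; apply/funext => j.
Qed.

Section Series2Zmodule.
Variable k : zmodType.
Implicit Types f g h : series2 k.

Definition series2_zero : series2 k := Series2 (fun _ _ => 0).
Definition series2_opp f := Series2 (fun i j => - coef f i j).
Definition series2_add f g := Series2 (fun i j => coef f i j + coef g i j).

Lemma series2_addA : associative series2_add.
Proof. by move=> f g h; apply: series2P => i j /=; rewrite addrA. Qed.
Lemma series2_addC : commutative series2_add.
Proof. by move=> f g; apply: series2P => i j /=; rewrite addrC. Qed.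
Lemma series2_add0 : left_id series2_zero series2_add.
Proof. by move=> f; apply: series2P => i j /=; rewrite add0r. Qed.
Lemma series2_addN : left_inverse series2_zero series2_opp series2_add.
Proof. by move=> f; apply: series2P => i j /=; rewrite addNr. Qed.

HB.instance Definition _ := GRing.isZmodule.Build (series2 k)
  series2_addA series2_addC series2_add0 series2_addN.
End Series2Zmodule.

Section Series2Ring.
Variable k : comNzRingType.
Implicit Types f g h : series2 k.

Definition series2_one : series2 k :=
  Series2 (fun i j => ((i == 0%N) && (j == 0%N))%:R).
Definition series2_mul f g : series2 k :=
  Series2 (fun i j => \sum_(a < i.+1) \sum_(b < j.+1)
                        coef f a b * coef g (i - a) (j - b)).

(* The ring laws are read off those of k[y][x], after truncation. *)
Definition series2_approx N f (p : {poly {poly k}}) :=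
  forall i j, (i < N)%N -> (j < N)%N -> p`_i`_j = coef f i j.

Definition series2_trunc N f : {poly {poly k}} :=
  \poly_(i < N) \poly_(j < N) coef f i j.

Lemma series2_truncP N f : series2_approx N f (series2_trunc N f).
Proof. by move=> i j iN jN; rewrite coef_poly iN coef_poly jN. Qed.

Lemma series2_approxM N f g p q : series2_approx N f p ->
  series2_approx N g q -> series2_approx N (series2_mul f g) (p * q).
Proof.
move=> fp gq i j iN jN; rewrite coefM coef_sum /=; apply: eq_bigr => a _.
rewrite coefM; apply: eq_bigr => b _.
rewrite fp ?gq ?(leq_ltn_trans (leq_subr _ _)) //.
- exact: leq_ltn_trans (leq_ord a) iN.
- exact: leq_ltn_trans (leq_ord b) jN.
Qed.

Lemma series2_approx1 N : series2_approx N series2_one 1.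
Proof.
by move=> i j _ _; rewrite coef1 /=; case: (i == 0%N); rewrite ?coef0 ?coef1.
Qed.

Lemma series2_approx_eq f g :
  (forall N, exists2 p, series2_approx N f p & series2_approx N g p) -> f = g.
Proof.
move=> fg; apply: series2P => i j; have [p fp gp] := fg (maxn i j).+1.
by rewrite -fp ?gp // ltnS ?leq_maxl ?leq_maxr.
Qed.

Lemma series2_mulA : associative series2_mul.
Proof.
move=> f g h; apply: series2_approx_eq => N.
exists (series2_trunc N f * (series2_trunc N g * series2_trunc N h)).
  by do 2?[apply: series2_approxM]; apply: series2_truncP.
by rewrite mulrA; do 2?[apply: series2_approxM]; apply: series2_truncP.
Qed.
Lemma series2_mulC : commutative series2_mul.
Proof.
move=> f g; apply: series2_approx_eq => N.
exists (series2_trunc N f * series2_trunc N g); last rewrite mulrC;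
  by apply: series2_approxM; apply: series2_truncP.
Qed.
Lemma series2_mul1 : left_id series2_one series2_mul.
Proof.
move=> f; apply: series2_approx_eq => N; exists (1 * series2_trunc N f).
  by apply: series2_approxM (series2_truncP f); apply: series2_approx1.
by rewrite mul1r; apply: series2_truncP.
Qed.
Lemma series2_mulDl : left_distributive series2_mul +%R.
Proof.
move=> f g h; apply: series2P => i j /=; rewrite -big_split.
apply: eq_bigr => a _ /=; rewrite -big_split; apply: eq_bigr => b _ /=.
by rewrite mulrDl.
Qed.
Lemma series2_oner_neq0 : series2_one != 0.
Proof.
apply/eqP => /(congr1 (fun f => coef f 0 0)) /= /eqP.
by rewrite (oner_eq0 k).
Qed.

HB.instance Definition _ := GRing.Zmodule_isComNzRing.Build (series2 k)
  series2_mulA series2_mulC series2_mul1 series2_mulDl series2_oner_neq0.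

Definition series2_X : series2 k :=
  Series2 (fun i j => ((i == 1%N) && (j == 0%N))%:R).
Definition series2_Y : series2 k :=
  Series2 (fun i j => ((i == 0%N) && (j == 1%N))%:R).

Definition ideal_xy : {pred series2 k} :=
  fun f => `[< exists g, f = g * (series2_X * series2_Y) >].

Lemma ideal_xy_closed : idealr_closed ideal_xy.
Proof.
split.
- by apply/asboolP; exists 0; rewrite mul0r.
- apply/asboolP => -[g /(congr1 (fun f => coef f 0 0)) /= /eqP]; rewrite !big_ord1 /=.
  by rewrite mulr0 mulr0 (oner_eq0 k).
- move=> a u v /asboolP[g ->] /asboolP[h ->]; apply/asboolP.
  by exists (a * g + h); rewrite mulrDl !mulrA.
Qed.

HB.instance Definition _ := isIdealr.Build (series2 k) ideal_xy ideal_xy_closed.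

Definition node : comNzRingType := {ideal_quot ideal_xy}.
End Series2Ring.

Section Endomorphisms.
Variables (R : comNzRingType) (M : lmodType R).

Definition endo := {linear M -> M}.

HB.instance Definition _ := gen_eqMixin endo.
HB.instance Definition _ := gen_choiceMixin endo.

Implicit Types f g h : endo.

Lemma endoP f g : (forall m, f m = g m) -> f = g.
Proof.
case: f g => [f [[f1] [f2]]] [g [[g1] [g2]]] /= /funext fg.
move: fg f1 f2 g1 g2 => -> f1 f2 g1 g2.
by rewrite (Prop_irrelevance f1 g1) (Prop_irrelevance f2 g2).
Qed.

Definition endo_zero : endo := \0.
Definition endo_opp f : endo := \- f.
Definition endo_add f g : endo := f \+ g.
Definition endo_one : endo := idfun.
Definition endo_mul f g : endo := f \o g.

Lemma endo_addA : associative endo_add.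
Proof. by move=> f g h; apply: endoP => m /=; rewrite addrA. Qed.
Lemma endo_addC : commutative endo_add.
Proof. by move=> f g; apply: endoP => m /=; rewrite addrC. Qed.
Lemma endo_add0 : left_id endo_zero endo_add.
Proof. by move=> f; apply: endoP => m /=; rewrite add0r. Qed.
Lemma endo_addN : left_inverse endo_zero endo_opp endo_add.
Proof. by move=> f; apply: endoP => m /=; rewrite addNr. Qed.

HB.instance Definition _ := GRing.isZmodule.Build endo
  endo_addA endo_addC endo_add0 endo_addN.

Lemma endo_mulA : associative endo_mul.
Proof. by move=> f g h; apply: endoP. Qed.
Lemma endo_mul1 : left_id endo_one endo_mul.
Proof. by move=> f; apply: endoP. Qed.
Lemma endo_mulr1 : right_id endo_one endo_mul.
Proof. by move=> f; apply: endoP. Qed.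
Lemma endo_mulDl : left_distributive endo_mul +%R.
Proof. by move=> f g h; apply: endoP. Qed.
Lemma endo_mulDr : right_distributive endo_mul +%R.
Proof. by move=> f g h; apply: endoP => m; apply: (linearD f). Qed.

HB.instance Definition _ := GRing.Zmodule_isPzRing.Build endo
  endo_mulA endo_mul1 endo_mulr1 endo_mulDl endo_mulDr.
End Endomorphisms.

Section GlobalDimension.
Variable S : pzRingType.

Definition projective (P : lmodType S) : Prop :=
  forall (A B : lmodType S) (g : {linear A -> B}) (f : {linear P -> B}),
    (forall b, exists a, g a = b) ->
    exists h : {linear P -> A}, forall p, g (h p) = f p.

(* Projective resolutions 0 -> P n -> ... -> P 1 -> P 0 -> M -> 0, extended by
   P i = 0 for i > n. *)
Definition pd_le (M : lmodType S) (n : nat) : Prop :=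
  exists (P : nat -> lmodType S) (d : forall i, {linear P i.+1 -> P i})
         (e : {linear P 0 -> M}),
    [/\ forall i, projective (P i),
        forall i, (n < i)%N -> forall p : P i, p = 0,
        forall m, exists p, e p = m,
        forall p, e p = 0 <-> exists q, d 0 q = p &
        forall i p, d i p = 0 <-> exists q, d i.+1 q = p].

(* All modules are left modules, not necessarily finitely generated.  For the
   two-sided Noetherian rings [endo M], with M finitely generated over a
   commutative Noetherian ring, the left and right global dimensions agree. *)
Definition gldim_le (n : nat) : Prop := forall M : lmodType S, pd_le M n.

Definition has_gldim (n : nat) : Prop :=
  gldim_le n /\ forall m, gldim_le m -> (n <= m)%N.
End GlobalDimension.

Section MaximalCohenMacaulay.
Variable R : comNzRingType.

Definition prime_chain (d : nat) (p : nat -> {pred R}) : Prop :=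
  (forall i, (i <= d)%N -> idealr_closed (p i) /\ prime_idealr_closed (p i)) /\
  (forall i, (i < d)%N ->
     {subset p i <= p i.+1} /\ ~ {subset p i.+1 <= p i}).

Definition krull_dim (d : nat) : Prop :=
  (exists p, prime_chain d p) /\
  forall e p, prime_chain e p -> (e <= d)%N.

Variable M : lmodType R.

Definition finitely_generated : Prop :=
  exists (n : nat) (v : 'I_n -> M), forall m, exists c : 'I_n -> R,
    m = \sum_i c i *: v i.

(* The submodule (s_1, ..., s_r) M. *)
Definition ideal_mul (s : seq R) : set M :=
  [set m | exists u : nat -> M, m = \sum_(i < size s) s`_i *: u i]%classic.

Definition regular_seq (s : seq R) : Prop :=
  (forall i, (i < size s)%N -> forall m : M,
     ideal_mul (take i s) (s`_i *: m) -> ideal_mul (take i s) m) /\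
  exists m : M, ~ ideal_mul s m.

(* From here on R is meant to be Noetherian local, so that its maximal ideal
   is the set of nonunits. *)
Definition nonunit (a : R) : Prop := ~ exists b, b * a = 1.

Definition has_depth (d : nat) : Prop :=
  (exists s, [/\ size s = d, forall a, a \in s -> nonunit a & regular_seq s]) /\
  forall s, (forall a, a \in s -> nonunit a) -> regular_seq s ->
    (size s <= d)%N.

(* depth M = dim R; this excludes M = 0, which has no regular sequence. *)
Definition maximal_CM : Prop :=
  finitely_generated /\ exists2 d, krull_dim d & has_depth d.
End MaximalCohenMacaulay.

Definition global_spectrum (R : comNzRingType) : set nat :=
  [set n | exists M : lmodType R,
     [/\ exists m : M, m <> 0, maximal_CM M & has_gldim (endo M) n]]%classic.

(* Main.v *)
(* A maximal Cohen-Macaulay module over R = k[[x,y]]/(xy) has no socle, which makes a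
   suitably minimal generating family split it as R^a + (R/y)^b + (R/x)^c. Let E be its
   endomorphism ring and K a first syzygy over E. The components of K at the summands R/y
   and R/x are free over discrete valuation rings; they generate a projective submodule
   U of K.
   - If a = 0, then U = K, so E is hereditary.
   - If a, b, c > 0, the component of K/U at R is a vector space over k, and lifting a basis
     of it resolves K in one step; thus gldim E <= 2.
   - If a, b > 0 and c = 0, the component of K/U at R is a k[[y]]-module, which costs one step
     more; thus gldim E <= 3.
   - If a > 0 and b = c = 0, the periodic resolution R --x--> R --y--> R shows that E has
     infinite global dimension.
   For the lower bounds, xM is an E-submodule of the module M, which is projective if a > 0,
   but xM is not; without summand R/x the syzygy of xM is yM, again not projective. *)

Require Import Defs.
From HB Require Import structures.
From mathcomp Require Import all_boot all_algebra ring_quotient ring.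
From mathcomp Require Import boolp classical_sets functions wochoice.

Set Implicit Arguments.
Unset Strict Implicit.
Unset Printing Implicit Defensive.
Import GRing.Theory.
Local Open Scope ring_scope.

(** * Submodules and quotient modules *)

(** Since [gldim_le] quantifies over arbitrary left modules, the upper bounds cannot rest on finite
    generation of K; bases come from a well-ordering of the coordinates or from Zorn's lemma. What
    makes this workable is that Hom(R v_i, M) is the set of elements of M killed by [c i]: a direct
    sum of left ideals [End M * idem i] is a module of finitely supported families in M, and K, as a
    submodule of such a sum, has coordinates in R. The rings R/x and R/y are never formed;
    statements about them are congruences in R, because coordinates with respect to [v] are
    determined only modulo [c i]. Until it is specialised at the end, the ring enters only through
    [nodal x y], which is symmetric in x and y, so a statement about one branch is proved once and
    transported by [nodal_sym]. *)

Section LinearMaps.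
Variable S : pzRingType.
Implicit Types A B : lmodType S.

Definition mklin A B (f : A -> B) (f_lin : linear f) : {linear A -> B} :=
  HB.pack f (GRing.isLinear.Build S A B *:%R f f_lin).

Lemma mklinE A B (f : A -> B) (f_lin : linear f) a : mklin f_lin a = f a.
Proof. by []. Qed.

End LinearMaps.

Section Submodules.
Variable S : pzRingType.

Record submodule (V : lmodType S) := Submodule {
  sm_mem :> V -> Prop;
  sm_0 : sm_mem 0;
  sm_lin : forall a u v, sm_mem u -> sm_mem v -> sm_mem (a *: u + v) }.

Variables (V : lmodType S) (W : submodule V).

Lemma sm_D u v : W u -> W v -> W (u + v).
Proof. by move=> Wu Wv; rewrite -[u]scale1r; apply: sm_lin. Qed.

Lemma sm_Z a u : W u -> W (a *: u).
Proof. by move=> Wu; rewrite -[a *: u]addr0; apply: sm_lin (sm_0 W). Qed.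

Lemma sm_N u : W u -> W (- u).
Proof. by move=> Wu; rewrite -scaleN1r; apply: sm_Z. Qed.

Lemma sm_B u v : W u -> W v -> W (u - v).
Proof. by move=> Wu Wv; apply: sm_D Wu (sm_N Wv). Qed.

Lemma sm_sum (I : Type) (s : seq I) (P : pred I) (F : I -> V) :
  (forall i, P i -> W (F i)) -> W (\sum_(i <- s | P i) F i).
Proof. by move=> WF; apply: big_ind => //; [apply: sm_0|apply: sm_D]. Qed.

Definition sm_pred : {pred V} := fun v => `[< W v >].

Lemma sm_predP v : reflect (W v) (v \in sm_pred).
Proof. exact: asboolP. Qed.

Lemma sm_closed : submod_closed sm_pred.
Proof.
split=> [|a u v]; first by apply/sm_predP/sm_0.
by move=> /sm_predP Wu /sm_predP Wv; apply/sm_predP/sm_lin.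
Qed.

HB.instance Definition _ := GRing.isSubmodClosed.Build S V sm_pred sm_closed.

Record subm := Subm { sm_val : V; sm_valP : sm_val \in sm_pred }.

HB.instance Definition _ := [isSub for sm_val].
HB.instance Definition _ := [Choice of subm by <:].
HB.instance Definition _ := [SubChoice_isSubLmodule of subm by <:].

Definition sm_incl : {linear subm -> V} := val.

Lemma sm_incl_inj : injective sm_incl.
Proof. exact: val_inj. Qed.

Lemma sm_inclP v : W v <-> exists w, sm_incl w = v.
Proof.
split=> [/sm_predP Wv|[w <-]]; first by exists (Subm Wv).
exact/sm_predP/sm_valP.
Qed.

(** Only the additive quotient of [ideal_quot] is borrowed, for a submodule in place of an ideal;
    the action of S is then defined on representatives. *)
Definition quotm : Type := {ideal_quot sm_pred}.
HB.instance Definition _ := GRing.Zmodule.copy quotm {ideal_quot sm_pred}.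
Definition quotm_pi (v : V) : quotm := \pi_{ideal_quot sm_pred}%qT v.

Lemma quotm_piP u v : quotm_pi u = quotm_pi v <-> W (u - v).
Proof.
split=> [/eqP|/sm_predP Wuv]; first by rewrite /quotm_pi -Quotient.idealrBE => /sm_predP.
by apply/eqP; rewrite /quotm_pi -Quotient.idealrBE.
Qed.

Lemma quotm_pi_surj q : exists v, quotm_pi v = q.
Proof. by exists (repr (q : {ideal_quot sm_pred})); apply: reprK. Qed.

Lemma quotm_piD u v : quotm_pi (u + v) = quotm_pi u + quotm_pi v.
Proof. exact: raddfD. Qed.

Definition quotm_scale (a : S) (q : quotm) : quotm :=
  quotm_pi (a *: repr (q : {ideal_quot sm_pred})).

Lemma quotm_scaleE a v : quotm_scale a (quotm_pi v) = quotm_pi (a *: v).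
Proof.
apply/quotm_piP; rewrite -scalerBr; apply: sm_Z; apply/quotm_piP.
exact: reprK.
Qed.

Lemma quotm_scaleA a b q :
  quotm_scale a (quotm_scale b q) = quotm_scale (a * b) q.
Proof. by case: (quotm_pi_surj q) => v <-; rewrite !quotm_scaleE scalerA. Qed.
Lemma quotm_scale1 : left_id 1 quotm_scale.
Proof. by move=> q; case: (quotm_pi_surj q) => v <-; rewrite quotm_scaleE scale1r. Qed.
Lemma quotm_scaleDr : right_distributive quotm_scale +%R.
Proof.
move=> a q r; case: (quotm_pi_surj q) => v <-; case: (quotm_pi_surj r) => w <-.
by rewrite -quotm_piD !quotm_scaleE -quotm_piD scalerDr.
Qed.
Lemma quotm_scaleDl q : {morph quotm_scale^~ q : a b / a + b}.
Proof.
move=> a b; case: (quotm_pi_surj q) => v <-.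
by rewrite !quotm_scaleE -quotm_piD scalerDl.
Qed.

HB.instance Definition _ := GRing.Zmodule_isLmodule.Build S quotm
  quotm_scaleA quotm_scale1 quotm_scaleDr quotm_scaleDl.

Lemma quotm_pi_linear : linear quotm_pi.
Proof. by move=> a u v; rewrite quotm_piD -quotm_scaleE. Qed.

Definition quotm_proj : {linear V -> quotm} := mklin quotm_pi_linear.

Lemma quotm_projP u v : quotm_proj u = quotm_proj v <-> W (u - v).
Proof. exact: quotm_piP. Qed.

Lemma quotm_proj0 u : quotm_proj u = 0 <-> W u.
Proof. by rewrite -(linear0 quotm_proj) quotm_projP subr0. Qed.

Lemma quotm_proj_surj q : exists v, quotm_proj v = q.
Proof. exact: quotm_pi_surj. Qed.

End Submodules.

(** * Projective dimension *)

Section ProjectiveDimension.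
Variable S : pzRingType.
Implicit Types A B K L M N P Q U : lmodType S.

Lemma lift_into_image U P K (u : {linear U -> K}) (g : {linear P -> K}) :
  injective u -> (forall p, exists a, u a = g p) ->
  exists h : {linear P -> U}, forall p, u (h p) = g p.
Proof.
move=> u_inj /choice[h uh].
have h_lin : linear h.
  by move=> a p q; apply: u_inj; rewrite linearP !uh linearP.
by exists (mklin h_lin).
Qed.

Lemma projective_retract P Q (r : {linear P -> Q}) (i : {linear Q -> P}) :
  cancel i r -> projective P -> projective Q.
Proof.
move=> ri Pp A B g f g_surj.
have [h gh] := Pp A B g (f \o r : {linear P -> B}) g_surj.
by exists (h \o i : {linear Q -> A}) => q /=; rewrite gh /= ri.
Qed.

Lemma copair_linear A B N (f : {linear A -> N}) (g : {linear B -> N}) :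
  linear (fun p : A * B => f p.1 + g p.2).
Proof. by move=> a p q /=; rewrite !linearP scalerDr addrACA. Qed.
Definition copair A B N (f : {linear A -> N}) (g : {linear B -> N}) :=
  mklin (copair_linear f g).

Lemma copairE A B N (f : {linear A -> N}) (g : {linear B -> N}) a b :
  copair f g (a, b) = f a + g b.
Proof. by []. Qed.

Lemma pair_linear A B N (f : {linear N -> A}) (g : {linear N -> B}) :
  linear (fun n => (f n, g n)).
Proof. by move=> a p q /=; rewrite !linearP. Qed.
Definition pairl A B N (f : {linear N -> A}) (g : {linear N -> B}) :
  {linear N -> (A * B)%type} := mklin (pair_linear f g).

Definition idl A : {linear A -> A} := idfun.
Definition zerol A B : {linear A -> B} := \0.
Lemma fst_linear A B : linear (fun p : A * B => p.1). Proof. by []. Qed.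
Definition fstl A B := mklin (@fst_linear A B).
Lemma snd_linear A B : linear (fun p : A * B => p.2). Proof. by []. Qed.
Definition sndl A B := mklin (@snd_linear A B).

Lemma projective_prod P Q :
  projective P -> projective Q -> projective (P * Q)%type.
Proof.
move=> Pp Qp A B g f g_surj.
have [h1 gh1] := Pp A B g (f \o pairl (idl P) (zerol P Q) : {linear P -> B}) g_surj.
have [h2 gh2] := Qp A B g (f \o pairl (zerol Q P) (idl Q) : {linear Q -> B}) g_surj.
exists (copair h1 h2) => -[p q] /=.
by rewrite linearD gh1 gh2 /= -linearD /=; congr (f (_, _)); rewrite ?addr0 ?add0r.
Qed.

Definition ses K P N (i : {linear K -> P}) (g : {linear P -> N}) : Prop :=
  [/\ injective i, forall n, exists p, g p = n &
      forall p, g p = 0 <-> exists k, i k = p].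

(** The inductive form of [pd_le], peeling off one syzygy at a time; dimension shifting is an
    induction on it. *)
Fixpoint pdi (n : nat) N : Prop :=
  if n is m.+1 then
    exists (P K : lmodType S) (i : {linear K -> P}) (g : {linear P -> N}),
      [/\ projective P, ses i g & pdi m K]
  else projective N.

Lemma pdi_retract_iso n M N (f : {linear M -> N}) (h : {linear N -> M}) :
  cancel f h -> cancel h f -> pdi n M -> pdi n N.
Proof.
move=> fh hf; case: n => [|n] /=; first exact: projective_retract hf.
case=> P [K [i [g [Pp [i_inj g_surj gi] Kn]]]].
exists P, K, i, (f \o g : {linear P -> N}); split=> //; split=> // [x|p].
  by have [p gp] := g_surj (h x); exists p; rewrite /= gp hf.
rewrite -gi /=; split=> [/(congr1 h)|->]; last exact: linear0.
by rewrite fh linear0.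
Qed.

Lemma lin_inverse M N (f : {linear M -> N}) :
  injective f -> (forall n, exists m, f m = n) ->
  exists h : {linear N -> M}, cancel f h /\ cancel h f.
Proof.
move=> f_inj f_surj; have [h fh] :=
  lift_into_image f_inj (f_surj : forall n, exists a, f a = idl N n).
by exists h; split=> // m; apply: f_inj; rewrite fh.
Qed.

Lemma pdi_iso n M N (f : {linear M -> N}) :
  injective f -> (forall n, exists m, f m = n) -> pdi n M -> pdi n N.
Proof.
move=> f_inj f_surj; have [h [fh hf]] := lin_inverse f_inj f_surj.
exact: pdi_retract_iso fh hf.
Qed.

Lemma pdi_prod_projective n L P :
  projective P -> pdi n L -> pdi n (L * P)%type.
Proof.
move=> Pp; case: n => [|n] /=; first by move=> Lp; apply: projective_prod.
case=> Q [K [i [g [Qp [i_inj g_surj gi] Kn]]]].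
exists (Q * P)%type, K, (pairl i (zerol K P)).
exists (pairl (g \o fstl Q P : {linear _ -> _}) (sndl Q P)).
split=> //; first exact: projective_prod.
split=> [k k' [] /i_inj //|[l p]|[q p] /=].
  have [q gq] := g_surj l; exists (q, p).
  by rewrite /= gq.
split.
  by case=> /gi[k <-] ->; exists k.
by case=> k [<- <-]; congr pair; apply/gi; exists k.
Qed.

(** Being projective, P lifts through g, so the kernel of the composite Q -> N * P -> N is L * P,
    where L is the kernel of g. *)
Lemma pdi_retract n N P :
  projective P -> pdi n (N * P)%type -> pdi n N.
Proof.
move=> Pp; case: n => [|n] /=.
  apply: (@projective_retract _ _ (fstl N P) (pairl (idl N) (zerol N P))).
  by [].
case=> Q [L [i [g [Qp [i_inj g_surj gi] Ln]]]].
have [s gs] := Pp _ _ g (pairl (zerol P N) (idl P)) g_surj.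
pose g1 : {linear Q -> N} := fstl N P \o g.
have g1E q : g1 q = (g q).1 by [].
exists Q, (L * P)%type, (copair i s), g1.
split=> //; last exact: pdi_prod_projective.
have gi0 l : g (i l) = 0 by apply/gi; exists l.
split=> [[l p] [l' p'] /= E|m|q].
- have Ep : p = p'.
    have := congr1 g E; rewrite !linearD !gi0 !gs !add0r => -[].
    by [].
  by move: E; rewrite Ep => /addIr/i_inj ->.
- by have [q gq] := g_surj (m, 0); exists q; rewrite g1E gq.
- rewrite g1E; split=> [gq|[[l p] /= <-]]; last first.
    by rewrite linearD gi0 add0r gs.
  have /gi[l il] : g (q - s (g q).2) = 0.
    by rewrite linearB gs /=; case: (g q) gq => a b /= ->; apply: subrr.
  by exists (l, (g q).2); rewrite /= il subrK.
Qed.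

(** Frees the syzygy from the resolution at hand: for lower bounds, a bound on N passes to the
    kernel of any convenient projective presentation. *)
Lemma schanuel n K P N (i : {linear K -> P}) (g : {linear P -> N}) :
  projective P -> ses i g -> pdi n.+1 N -> pdi n K.
Proof.
move=> Pp [i_inj g_surj gi] [P1 [K1 [i1 [g1 [P1p [i1_inj g1_surj gi1] K1n]]]]].
have [a ga] := Pp _ _ g1 g g1_surj.
have [b gb] := P1p _ _ g g1 g_surj.
have gi0 k : g (i k) = 0 by apply/gi; exists k.
have gi10 k : g1 (i1 k) = 0 by apply/gi1; exists k.
(* Both K * P1 and K1 * P are isomorphic to the fibre product of P and P1. *)
pose f1 : {linear (K1 * P)%type -> P1} := copair i1 a.
pose f2 : {linear (K * P1)%type -> P} := copair i b.
pose D1 : {linear (K1 * P)%type -> (P * P1)%type} := pairl (sndl K1 P) f1.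
pose D2 : {linear (K * P1)%type -> (P * P1)%type} := pairl f2 (sndl K P1).
have D1E x : D1 x = (x.2, i1 x.1 + a x.2) by [].
have D2E x : D2 x = (i x.1 + b x.2, x.2) by [].
have D1_inj : injective D1.
  move=> [k p] [k' p']; rewrite !D1E /= => -[<-] /addIr/i1_inj -> //.
have D2_inj : injective D2.
  by move=> [k p] [k' p']; rewrite !D2E /= => -[E Ep]; move: E; rewrite Ep => /addIr/i_inj ->.
have [h Dh] : exists h : {linear (K1 * P)%type -> (K * P1)%type}, forall x, D2 (h x) = D1 x.
  apply: (lift_into_image D2_inj) => -[k p].
  have /gi[l il] : g (p - b (i1 k + a p)) = 0.
    by rewrite linearB gb linearD gi10 add0r ga subrr.
  by exists (l, i1 k + a p); rewrite D1E D2E /= il subrK.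
apply: (@pdi_retract n K P1) => //.
apply: (@pdi_iso n _ _ h); last exact: pdi_prod_projective.
  by move=> x y /(congr1 D2); rewrite !Dh => /D1_inj.
move=> [k p].
have /gi1[l il] : g1 (p - a (i k + b p)) = 0.
  by rewrite linearB ga linearD gi0 add0r gb subrr.
by exists (l, i k + b p); apply: D2_inj; rewrite Dh D1E D2E /= il subrK.
Qed.

(* L is the preimage of U in P, so that 0 -> L -> U * P -> K -> 0 is exact. *)
Lemma pdi_amalgam n U P L K (u : {linear U -> K}) (phi : {linear P -> K})
    (j : {linear L -> P}) :
  projective U -> projective P -> injective u -> injective j ->
  (forall k, exists a p, k = u a + phi p) ->
  (forall p, (exists a, u a = phi p) <-> exists l, j l = p) ->
  pdi n L -> pdi n.+1 K.
Proof.
move=> Up Pp u_inj j_inj gen jP Ln.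
have [h uh] : exists h : {linear L -> U}, forall l, u (h l) = (phi \o j : {linear L -> K}) l.
  by apply: lift_into_image => // l; apply/jP; exists l.
have hN_lin : linear (fun l => - h l) by move=> a x y; rewrite linearP opprD scalerN.
exists (U * P)%type, L, (pairl (mklin hN_lin) j), (copair u phi).
split=> //; first exact: projective_prod.
split=> [x y [_ /j_inj] //|k|[a p] /=].
  by have [a [p ->]] := gen k; exists (a, p).
split=> [E|[l [<- <-]]]; last by rewrite linearN uh /= addNr.
have uaN : u (- a) = phi p.
  by rewrite linearN; apply/eqP; rewrite eq_sym -addr_eq0 addrC E.
have [l lp] : exists l, j l = p by apply/jP; exists (- a).
exists l; rewrite lp; congr pair; apply/eqP; rewrite eqr_oppLR; apply/eqP.
by apply: u_inj; rewrite uh /= lp uaN.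
Qed.

End ProjectiveDimension.

Section PdLe.
Variable S : pzRingType.
Implicit Types K M N P : lmodType S.

Lemma ker_lin M N (f : {linear M -> N}) a u v :
  f u = 0 -> f v = 0 -> f (a *: u + v) = 0.
Proof. by move=> fu fv; rewrite linearP fu fv scaler0 addr0. Qed.
Definition kerm M N (f : {linear M -> N}) :=
  @Submodule S M (fun u => f u = 0) (linear0 f) (@ker_lin M N f).

Lemma zerom_lin M a (u v : M) : u = 0 -> v = 0 -> a *: u + v = 0.
Proof. by move=> -> ->; rewrite scaler0 addr0. Qed.
Definition zerom M := @Submodule S M (fun u => u = 0) erefl (@zerom_lin M).

Lemma range_0 M N (f : {linear M -> N}) : exists m, f m = 0.
Proof. by exists 0; rewrite linear0. Qed.
Lemma range_lin M N (f : {linear M -> N}) a u v :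
  (exists m, f m = u) -> (exists m, f m = v) -> exists m, f m = a *: u + v.
Proof. by move=> [m <-] [n <-]; exists (a *: m + n); rewrite linearP. Qed.
Definition rangem M N (f : {linear M -> N}) :=
  @Submodule S N (fun u => exists m, f m = u) (range_0 f) (@range_lin M N f).

Lemma ses_ker P N (g : {linear P -> N}) :
  (forall n, exists p, g p = n) -> ses (sm_incl (kerm g)) g.
Proof.
by move=> g_surj; split=> [||p]; [apply: sm_incl_inj|apply: g_surj|apply: (sm_inclP (kerm g))].
Qed.

Lemma corestrict P M (W : submodule M) (f : {linear P -> M}) :
  (forall p, W (f p)) ->
  exists h : {linear P -> subm W}, forall p, sm_incl W (h p) = f p.
Proof.
by move=> Wf; apply: lift_into_image (@sm_incl_inj _ _ W) _ => p; apply/sm_inclP.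
Qed.

Lemma pdi_of_pd_le n N : pd_le N n -> pdi n N.
Proof.
elim: n N => [|n IHn] N [P [d [e [Pp Pz e_surj e0 dx]]]].
  apply: (@pdi_iso _ 0 _ _ e) (Pp 0%N) => // p q epq; apply/eqP; rewrite -subr_eq0; apply/eqP.
  have /e0[r <-] : e (p - q) = 0 by rewrite linearB epq subrr.
  by rewrite (Pz 1%N isT r) linear0.
(* [d 0] maps onto the kernel of e, so the shifted complex resolves that kernel. *)
have [e' e'E] := @corestrict _ _ (kerm e) (d 0%N) (fun q => (e0 _).2 (ex_intro _ q erefl)).
exists (P 0%N), (subm (kerm e)), (sm_incl _), e; split=> //; first exact: ses_ker.
apply: IHn; exists (fun i => P i.+1), (fun i => d i.+1), e'; split=> //.
- by move=> i ni p; apply: Pz.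
- move=> m; have /e0[q dq] : e (sm_incl _ m) = 0 by apply/(sm_inclP (kerm e)); exists m.
  by exists q; apply: (@sm_incl_inj _ _ (kerm e)); rewrite e'E.
- move=> p; rewrite -dx -e'E; split=> [->|]; first exact: linear0.
  by move=> E; apply: (@sm_incl_inj _ _ (kerm e)); rewrite E linear0.
Qed.

Lemma pd_le_of_pdi n N : pdi n N -> pd_le N n.
Proof.
elim: n N => [|n IHn] N /= => [Np|[P0 [K [i [g [P0p [i_inj g_surj gi] /IHn]]]]]].
  pose P j : lmodType S := if j is 0%N then N else subm (zerom N).
  have Pz j : (0 < j)%N -> forall p : P j, p = 0.
    case: j => // j _ p; apply: (@sm_incl_inj _ _ (zerom N)).
    by rewrite linear0; apply/(sm_inclP (zerom N)); exists p.
  exists P, (fun j => \0 : {linear P j.+1 -> P j}), (idl N); split=> //.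
  - by case=> [//|j] A B f h /(_ 0)[a fa]; exists (\0 : {linear _ -> A}) => p;
      rewrite (Pz j.+1 isT p) !linear0.
  - by move=> m; exists m.
  - by move=> p; split=> [/= ->|[q <-]//]; exists 0.
  - by move=> j p; split=> // _; exists 0; rewrite (Pz j.+1 isT p).
case=> P [d [e [Pp Pz e_surj e0 dx]]].
pose Q j : lmodType S := if j is j'.+1 then P j' else P0.
pose dQ j : {linear Q j.+1 -> Q j} :=
  if j is j'.+1 then d j' else (i \o e : {linear P 0%N -> P0}).
exists Q, dQ, g; split=> //.
- by case.
- by case=> // j nj p; apply: Pz.
- move=> p; rewrite gi; split=> [[k <-]|[q <-]]; last by exists (e q).
  by have [q <-] := e_surj k; exists q.
- case=> [|j] p; last exact: dx.
  rewrite -e0 /=; split=> [|->]; last exact: linear0.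
  by move=> E; apply: i_inj; rewrite E linear0.
Qed.

(** K is the first syzygy of the quotient of P by the image of i. *)
Lemma gldim_le_syzygy n K P (i : {linear K -> P}) :
  gldim_le S n.+1 -> projective P -> injective i -> pdi n K.
Proof.
move=> Sn Pp i_inj.
have := pdi_of_pd_le (Sn (quotm (rangem i))).
apply: (@schanuel _ n K P _ i (quotm_proj (rangem i)) Pp).
by split=> [//||p]; [apply: quotm_proj_surj|apply: quotm_proj0].
Qed.

(** The quotient of P by K is projective, so its projection has a section s; subtracting s after the
    projection from the identity maps P into the image of i. *)
Lemma gldim_le0_retract K P (i : {linear K -> P}) :
  gldim_le S 0 -> injective i ->
  exists r : {linear P -> K}, cancel i r.
Proof.
move=> S0 i_inj; pose W := rangem i.
have Qp : projective (quotm W) := pdi_of_pd_le (S0 (quotm W)).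
have [s ps] := Qp _ _ (quotm_proj W) (idl _) (@quotm_proj_surj _ _ W).
pose f : {linear P -> P} := idl P \- (s \o quotm_proj W).
have [r ir] : exists r : {linear P -> K}, forall p, i (r p) = f p.
  apply: lift_into_image => // p; rewrite /f /=.
  by have : W (p - s (quotm_proj W p)) by apply/quotm_projP; rewrite ps.
exists r => k; apply: i_inj; rewrite ir.
have E : quotm_proj W (i k) = 0 by apply/quotm_proj0; exists k.
have -> : f (i k) = i k - s (quotm_proj W (i k)) by [].
by rewrite E linear0 subr0.
Qed.

End PdLe.

(** * Modules over nodal rings *)

Section Nodal.
Variable R : comNzRingType.
Implicit Types x y c r s : R.

Definition dv c r : Prop := exists s, r = c * s.

Lemma dvD c r s : dv c r -> dv c s -> dv c (r + s).
Proof. by move=> [a ->] [b ->]; exists (a + b); rewrite mulrDr. Qed.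
Lemma dvN c r : dv c r -> dv c (- r).
Proof. by move=> [a ->]; exists (- a); rewrite mulrN. Qed.
Lemma dvB c r s : dv c r -> dv c s -> dv c (r - s).
Proof. by move=> cr cs; apply: dvD => //; apply: dvN. Qed.
Lemma dvM c r s : dv c r -> dv c (r * s).
Proof. by move=> [a ->]; exists (a * s); rewrite mulrA. Qed.
Lemma dvMl c r s : dv c r -> dv c (s * r).
Proof. by rewrite mulrC; apply: dvM. Qed.
Lemma dvr c : dv c c. Proof. by exists 1; rewrite mulr1. Qed.
Lemma dv0 c : dv c 0. Proof. by exists 0; rewrite mulr0. Qed.
Lemma dv0P r : dv 0 r <-> r = 0.
Proof. by split=> [[s ->]|->]; [rewrite mul0r|apply: dv0]. Qed.
Lemma dv_sum c (I : Type) (l : seq I) (P : pred I) (F : I -> R) :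
  (forall i, P i -> dv c (F i)) -> dv c (\sum_(i <- l | P i) F i).
Proof. by move=> cF; apply: big_ind => //; [apply: dv0|apply: dvD]. Qed.

(* R / y is a discrete valuation ring with uniformizer x, and y generates the annihilator of x. *)
Record branch x y : Prop := Branch {
  br_ann : forall r, x * r = 0 -> dv y r;
  br_dvr : forall r, dv y r \/
    exists n u v s, v * u = 1 /\ r = x ^+ n * u + y * s;
  br_pow : forall n, ~ dv y (x ^+ n) }.

(** [nd_local] and [nd_1] together say that R is local with maximal ideal (x, y). *)
Record nodal x y : Prop := Nodal {
  nd_mul : x * y = 0;
  nd_local : forall r, (exists s, s * r = 1) \/ exists a b, r = x * a + y * b;
  nd_1 : forall a b, 1 <> x * a + y * b;
  nd_x : branch x y;
  nd_y : branch y x }.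

Lemma nodal_sym x y : nodal x y -> nodal y x.
Proof.
case=> xy loc n1 bx by_; split=> //; first by rewrite mulrC.
  by move=> r; case: (loc r) => [|[a [b ->]]]; [left|right; exists b, a; rewrite addrC].
by move=> a b; rewrite addrC.
Qed.

Variables (x y : R) (xyP : nodal x y).

(** Modulo y, two elements not divisible by y are units times powers of x; if y divided their
    product, it would divide a power of x. *)
Lemma nd_dvM r s : dv y (r * s) -> dv y r \/ dv y s.
Proof.
case: (br_dvr (nd_x xyP) r) => [|[n [u [u' [a [uu' ->]]]]]]; first by left.
case: (br_dvr (nd_x xyP) s) => [|[m [v [v' [b [vv' ->]]]]]]; first by right.
move=> H; case: (br_pow (nd_x xyP) (n := n + m)).
suff -> : x ^+ (n + m) = u' * v' * ((x ^+ n * u + y * a) * (x ^+ m * v + y * b))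
   - y * (u' * v' * (a * (x ^+ m * v + y * b) + x ^+ n * u * b)).
  by apply: dvB; [apply: dvMl|apply: dvM; apply: dvr].
transitivity ((u' * u) * (v' * v) * x ^+ n * x ^+ m).
  by rewrite uu' vv' !mul1r exprD.
ring.
Qed.

Lemma nd_dvx r : dv y (x * r) -> dv y r.
Proof.
by case/nd_dvM => // H; case: (br_pow (nd_x xyP) (n := 1)).
Qed.

Lemma nd_dvxy r : dv x r -> dv y r -> r = 0.
Proof.
by move=> [a ->] /nd_dvx[b ->]; rewrite mulrA (nd_mul xyP) mul0r.
Qed.

Lemma nd_ann r : x * r = 0 <-> dv y r.
Proof.
split=> [/(br_ann (nd_x xyP))//|[s ->]]; by rewrite mulrA (nd_mul xyP) mul0r.
Qed.

(** In the discrete valuation ring R/y an ideal is generated by an element of least valuation; [Q n]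
    says that L attains the valuation n. *)
Lemma nd_principal (L : R -> Prop) : L 0 -> (forall a r s, L r -> L s -> L (a * r + s)) ->
  exists d, L d /\ forall r, L r -> exists a, dv y (r - a * d).
Proof.
move=> L0 LM.
pose Q n := `[< exists r u v s, [/\ L r, v * u = 1 & r = x ^+ n * u + y * s] >].
have [exQ|nQ] := pselect (exists n, Q n); last first.
  exists 0; split=> // r Lr; exists 0; rewrite mul0r subr0.
  case: (br_dvr (nd_x xyP) r) => // -[n [u [v [s [vu rE]]]]].
  by case: nQ; exists n; apply/asboolP; exists r, u, v, s.
case: (ex_minnP exQ) => n /asboolP[d [u [v [s [Ld vu dE]]]]] n_min.
exists d; split=> // r Lr.
case: (br_dvr (nd_x xyP) r) => [yr|[m [u' [v' [t [vu' rE]]]]]].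
  by exists 0; rewrite mul0r subr0.
have nm : (n <= m)%N by apply: n_min; apply/asboolP; exists r, u', v', t.
exists (x ^+ (m - n) * u' * v); rewrite rE dE.
suff -> : x ^+ m * u' + y * t - x ^+ (m - n) * u' * v * (x ^+ n * u + y * s) =
   y * (t - x ^+ (m - n) * u' * v * s) by apply: dvM; apply: dvr.
rewrite -{1}(subnK nm) exprD -[X in X * u' + _]mulr1 -vu; ring.
Qed.

(** * Relations in generating families of minimal weight *)

Section Classification.
Variable M : lmodType R.

Definition genfam n (v : 'I_n -> M) (c : 'I_n -> R) : Prop :=
  [/\ forall i, c i \in [:: 0; x; y], forall i, c i *: v i = 0 &
      forall m, exists r : 'I_n -> R, m = \sum_i r i *: v i].

(* Generators count once, and once more when they are not known to be torsion: a family
   of minimal weight is a decomposition. *)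
Definition genwt n (c : 'I_n -> R) : nat := (\sum_i (1 + (c i == 0%R)))%N.

Definition reducible n (c : 'I_n -> R) : Prop :=
  exists n' (v' : 'I_n' -> M) (c' : 'I_n' -> R),
    genfam v' c' /\ (genwt c' < genwt c)%N.

(** The relation can be solved for [v i0], whose coefficient has inverse t. *)
Lemma genfam_remove n (v : 'I_n -> M) (c r : 'I_n -> R) i0 t :
  genfam v c -> t * r i0 = 1 -> \sum_i r i *: v i = 0 -> reducible c.
Proof.
case: n v c r i0 => [|n] v c r i0; first by case: i0.
move=> [cP cv gen] tr rel.
exists n, (v \o lift i0), (c \o lift i0); split; last first.
  by rewrite /genwt [ltnRHS](bigD1_ord i0) //= -addnA add1n ltnS leq_addl.
split=> [i|i|m]; [exact: cP|exact: cv|have [s ->] := gen m].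
have v0 : v i0 = - \sum_j (t * r (lift i0 j)) *: v (lift i0 j).
  move/(congr1 (fun m => t *: m)): rel; rewrite scaler0 (bigD1_ord i0) //=.
  rewrite scalerDr scalerA tr scale1r scaler_sumr => /eqP.
  rewrite addr_eq0 => /eqP ->; congr (- _); apply: eq_bigr => j _.
  by rewrite scalerA.
exists (fun j => s (lift i0 j) - s i0 * (t * r (lift i0 j))).
rewrite (bigD1_ord i0) //= v0 scalerN scaler_sumr -sumrN -big_split /=.
by apply: eq_bigr => j _; rewrite scalerBl scalerA addrC.
Qed.

(** Since its coefficient at i0 is a unit, m can take the place of [v i0]. It is killed by x and
    counts once, whereas [v i0] counted twice. *)
Lemma genfam_replace n (v : 'I_n -> M) (c r : 'I_n -> R) i0 t m :
  genfam v c -> c i0 = 0 -> t * r i0 = 1 -> m = \sum_i r i *: v i ->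
  x *: m = 0 -> reducible c.
Proof.
move=> [cP cv gen] c0 tr mE xm.
exists n, (fun i => if i == i0 then m else v i), (fun i => if i == i0 then x else c i).
have x0 : (x == 0) = false.
  by apply/negP=> /eqP H; case: (br_pow (nd_x xyP) (n := 1)); rewrite expr1 H; apply: dv0.
split; last first.
  rewrite /genwt (bigD1 i0) //= [ltnRHS](bigD1 i0) //= eqxx c0 eqxx x0.
  rewrite addn0 -addnA ltn_add2l add1n ltnS.
  by apply: leq_sum => i /negPf ->.
split=> [i|i|m'].
- by case: eqP => // _; rewrite !inE eqxx orbT.
- by case: eqP.
- have [s ->] := gen m'.
  exists (fun i => if i == i0 then s i0 * t else s i - s i0 * t * r i).
  have {}mE : m = r i0 *: v i0 + \sum_(i | i != i0) r i *: v i by rewrite mE (bigD1 i0).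
  rewrite (bigD1 i0) //= [RHS](bigD1 i0) //= eqxx mE scalerDr scalerA.
  rewrite -mulrA tr mulr1 -addrA; congr (_ + _).
  rewrite scaler_sumr -big_split; apply: eq_bigr => i /negPf -> /=.
  by rewrite scalerBl scalerA addrC subrK.
Qed.

Hypothesis soc0 : forall m : M, x *: m = 0 -> y *: m = 0 -> m = 0.

(** As y also kills every positive power of x, a shorter power times m would lie in the socle. *)
Lemma soc_pow n (m : M) : x ^+ n.+1 *: m = 0 -> x *: m = 0.
Proof.
elim: n => [|n IHn]; first by rewrite expr1.
rewrite exprS -scalerA => xm; apply: IHn; apply: soc0 => //.
by rewrite scalerA exprS mulrA [y * x]mulrC (nd_mul xyP) mul0r scale0r.
Qed.


(** Modulo y, the lowest power of x is factored out of the coefficients, which leaves a unit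
    somewhere. Generators with [c i = x] are left out: they vanish once the relation is multiplied
    by x. *)
Lemma common_power n (c r : 'I_n -> R) :
  (forall i, c i != x -> dv y (r i)) \/
  exists k (q s : 'I_n -> R), (forall i, c i != x -> r i = x ^+ k * q i + y * s i) /\
    exists i t, c i != x /\ t * q i = 1.
Proof.
pose Q k := `[< exists i u t s, [/\ c i != x, t * u = 1 & r i = x ^+ k * u + y * s] >].
have [exQ|nQ] := pselect (exists k, Q k); last first.
  left=> i cx; case: (br_dvr (nd_x xyP) (r i)) => // -[k [u [t [s [tu rE]]]]].
  by case: nQ; exists k; apply/asboolP; exists i, u, t, s.
right; case: (ex_minnP exQ) => k /asboolP[i0 [u [t [s0 [cx0 tu r0E]]]]] k_min.
exists k.
(* The second clause pins the choice at i0, so that the unit u is not lost. *)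
have /choice[qs qsP] : forall i, exists qs : R * R,
    (c i != x -> r i = x ^+ k * qs.1 + y * qs.2) /\ (i = i0 -> qs.1 = u).
  move=> i; have [->|/eqP ii0] := eqVneq i i0; first by exists (u, s0).
  have [cx|cx] := eqVneq (c i) x; first by exists (0, 0).
  case: (br_dvr (nd_x xyP) (r i)) => [[s ->]|[m [u' [t' [s [tu' rE]]]]]].
    by exists (0, s); split=> // _; rewrite mulr0 add0r.
  exists (x ^+ (m - k) * u', s); split=> //= _.
  rewrite mulrA -exprD subnKC //; apply: k_min; apply/asboolP.
  by exists i, u', t', s.
exists (fun i => (qs i).1), (fun i => (qs i).2); split=> [i|]; first exact: (qsP i).1.
by exists i0, t; rewrite ((qsP i0).2 erefl).
Qed.

(** Otherwise write r_i = x^k q_i + y s_i with some q_i a unit, and let m be the sum of the q_i v_i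
    with c_i <> x. Multiplying the relation by x gives x^(k+1) m = 0, so x m = 0. If a generator
    with c_i = 0 has a unit q_i, then m can replace it. If none has, the units sit at generators
    killed by y, and m can be corrected to a relation that removes one of them. Both contradict
    irreducibility. *)
Lemma relation_coef n (v : 'I_n -> M) (c r : 'I_n -> R) :
  genfam v c -> ~ reducible c -> \sum_i r i *: v i = 0 ->
  forall i, c i != x -> dv y (r i).
Proof.
move=> gvc nred rel; case: (common_power c r) => // -[k [q [s [rE [i0 [t [cx0 tq]]]]]]].
have [cP cv gen] := gvc.
pose m := \sum_(i | c i != x) q i *: v i.
have xm : x *: m = 0.
  apply: (@soc_pow k); rewrite exprS -scalerA.
  have -> : x ^+ k *: m = \sum_(i | c i != x) (r i *: v i - (y * s i) *: v i).
    rewrite scaler_sumr; apply: eq_bigr => i cx.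
    by rewrite -scalerBl rE // addrK scalerA.
  rewrite sumrB scalerBr.
  have -> : x *: (\sum_(i | c i != x) (y * s i) *: v i) = 0.
    rewrite scaler_sumr big1 // => i _.
    by rewrite scalerA mulrA (nd_mul xyP) mul0r scale0r.
  rewrite subr0; have := congr1 (fun m => x *: m) rel.
  rewrite scaler0 (bigID (fun i => c i != x)) /= scalerDr.
  have -> : x *: (\sum_(i | ~~ (c i != x)) r i *: v i) = 0.
    rewrite scaler_sumr big1 // => i /negPn/eqP cx.
    by rewrite scalerA mulrC -scalerA -cx cv scaler0.
  by rewrite addr0.
have mE : m = \sum_i (if c i != x then q i else 0) *: v i.
  by rewrite /m big_mkcond; apply: eq_bigr => i _; case: ifP; rewrite ?scale0r.
have [[i1 [t1 [c1 tq1]]]|nunit] := pselect (exists i1 t1, c i1 = 0 /\ t1 * q i1 = 1).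
  case: nred; apply: (@genfam_replace n v c _ i1 t1 m gvc c1 _ mE xm).
  rewrite c1 ifT // -c1.
  by apply/eqP=> H; case: (br_pow (nd_x xyP) (n := 1)); rewrite expr1 -H c1; apply: dv0.
exfalso.
have /choice[pp ppP] : forall i, exists p : R * R, c i = 0 -> q i = x * p.1 + y * p.2.
  move=> i; have [ci|/eqP ci] := eqVneq (c i) 0; last by exists (0, 0).
  case: (nd_local xyP (q i)) => [[t1 tq1]|[a [b qE]]]; last by exists (a, b).
  by case: nunit; exists i, t1.
(* Dropping the multiples of y at the generators with [c i = 0] does not change the product with x,
   and makes y kill the combination too; having no socle, M turns it into a relation. *)
pose q' i := if c i != x then (if c i == 0 then x * (pp i).1 else q i) else 0.
apply: nred; apply: (@genfam_remove n v c q' i0 t gvc).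
  rewrite /q' cx0 ifF //; apply/negP=> /eqP ci0.
  by case: nunit; exists i0, t.
apply: soc0.
  rewrite -{}[RHS]xm; apply/eqP; rewrite -subr_eq0 -scalerBr mE -sumrB scaler_sumr.
  apply/eqP/big1 => i _; rewrite -scalerBl scalerA /q'.
  case: ifP => _; last by rewrite subrr mulr0 scale0r.
  case: eqP => [/ppP ->|_]; last by rewrite subrr mulr0 scale0r.
  by rewrite opprD addrA subrr sub0r mulrN mulrA (nd_mul xyP) mul0r oppr0 scale0r.
rewrite scaler_sumr big1 // => i _; rewrite scalerA /q'.
have := cP i; rewrite !inE; case: ifP => [ncx|_ _]; last by rewrite mulr0 scale0r.
rewrite (negPf ncx) /=; case: eqP => [_ _|_ /eqP ciy].
  by rewrite mulrA [y * x]mulrC (nd_mul xyP) mul0r scale0r.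
by rewrite mulrC -scalerA -ciy cv scaler0.
Qed.

End Classification.
End Nodal.

Section Decomposition.
Variables (R : comNzRingType) (M : lmodType R).
Implicit Types x y : R.

(* M is the internal direct sum of the R v_i, and R v_i = R / (c i) is R, R/(x) or R/(y). *)
Definition decomposed x y n (v : 'I_n -> M) (c : 'I_n -> R) : Prop :=
  genfam x y v c /\ forall r, \sum_i r i *: v i = 0 -> forall i, dv (c i) (r i).

Lemma genfam_sym x y n (v : 'I_n -> M) (c : 'I_n -> R) :
  genfam x y v c -> genfam y x v c.
Proof.
by case=> cP cv gen; split=> // i; have := cP i; rewrite !inE => /or3P[] ->; rewrite ?orbT.
Qed.

Lemma decomposed_sym x y n (v : 'I_n -> M) (c : 'I_n -> R) :
  decomposed x y v c -> decomposed y x v c.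
Proof. by case=> /genfam_sym. Qed.

Lemma reducible_sym x y n (c : 'I_n -> R) :
  reducible x y M c -> reducible y x M c.
Proof. by case=> n' [v' [c' [/genfam_sym g lt]]]; exists n', v', c'. Qed.

(** Starting from [c = 0], the weight decreases until the family is irreducible. Then
    [relation_coef] applies on both branches; at [c i = 0] it makes the coefficient divisible by x
    and by y, hence zero. *)
Lemma decomposition_exists x y : nodal x y -> finitely_generated M ->
  (forall m : M, x *: m = 0 -> y *: m = 0 -> m = 0) ->
  exists n (v : 'I_n -> M) (c : 'I_n -> R), decomposed x y v c.
Proof.
move=> xyP [n [v gen]] soc0.
have : genfam x y v (fun=> 0).
  by split=> // i; rewrite ?inE ?eqxx ?scale0r.
move: (fun=> 0) => c {gen}.
move: {2}(genwt c) (leqnn (genwt c)) => w.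
elim: w n v c => [|w IHw] n v c wt gvc; last first.
  have [[n' [v' [c' [gvc' lt]]]]|nred] := pselect (reducible x y M c).
    by apply: (IHw n' v' c') => //; rewrite -ltnS; apply: leq_trans lt wt.
  exists n, v, c; split=> // r rel i.
  have h1 := relation_coef xyP soc0 gvc nred rel (i := i).
  have h2 : c i != y -> dv x (r i).
    apply: (relation_coef (nodal_sym xyP) _ (genfam_sym gvc) _ rel (i := i)).
      by move=> m ym xm; apply: soc0.
    by move/reducible_sym.
  have [cP _ _] := gvc; have := cP i; rewrite !inE => /or3P[]/eqP ci.
  - rewrite ci; apply/dv0P; apply: (nd_dvxy xyP).
      apply: h2; rewrite ci; apply/eqP=> H; case: (br_pow (nd_y xyP) (n := 1)).
      by rewrite expr1 -H; apply: dv0.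
    apply: h1; rewrite ci; apply/eqP=> H; case: (br_pow (nd_x xyP) (n := 1)).
      by rewrite expr1 -H; apply: dv0.
  - rewrite ci; apply: h2; rewrite ci; apply/eqP=> H.
    by case: (br_pow (nd_x xyP) (n := 1)); rewrite expr1 H; apply: dvr.
  - rewrite ci; apply: h1; rewrite ci; apply/eqP=> H.
    by case: (br_pow (nd_x xyP) (n := 1)); rewrite expr1 -H; apply: dvr.
case: n v c wt gvc => [|n] v c wt gvc.
  by exists 0%N, v, c; split=> // r _ [].
by move: wt; rewrite /genwt big_ord_recl.
Qed.

End Decomposition.

(** * Endomorphism rings *)

(* M as a module over its endomorphism ring; the alias hides the R-module structure. *)
Definition emod (R : comNzRingType) (M : lmodType R) : Type := M.

Section EndomorphismModule.
Variables (R : comNzRingType) (M : lmodType R).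

HB.instance Definition _ := GRing.Zmodule.copy (emod M) M.

Definition emod_scale (f : endo M) (m : emod M) : emod M := f m.

Lemma emod_scaleA f g m : emod_scale f (emod_scale g m) = emod_scale (f * g) m.
Proof. by []. Qed.
Lemma emod_scale1 : left_id 1 emod_scale.
Proof. by []. Qed.
Lemma emod_scaleDr : right_distributive emod_scale +%R.
Proof. by move=> f m m'; apply: (linearD f). Qed.
Lemma emod_scaleDl m : {morph emod_scale^~ m : f g / f + g}.
Proof. by []. Qed.

HB.instance Definition _ := GRing.Zmodule_isLmodule.Build (endo M) (emod M)
  emod_scaleA emod_scale1 emod_scaleDr emod_scaleDl.

Lemma emodZ (f : endo M) (m : emod M) : f *: m = f m.
Proof. by []. Qed.

Lemma homothety_linear (r : R) : linear (fun m : M => r *: m).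
Proof. by move=> a m m'; rewrite scalerDr !scalerA mulrC. Qed.
Definition homothety (r : R) : endo M := mklin (homothety_linear r).

Lemma homothetyE r m : homothety r m = r *: m. Proof. by []. Qed.

Lemma homothetyD r s : homothety (r + s) = homothety r + homothety s.
Proof. by apply: endoP => m; rewrite /= scalerDl. Qed.
Lemma homothetyM r s : homothety (r * s) = homothety r * homothety s.
Proof. by apply: endoP => m; rewrite /= scalerA. Qed.
Lemma homothety1 : homothety 1 = 1.
Proof. by apply: endoP => m; rewrite /= scale1r. Qed.
Lemma homothetyC r f : homothety r * f = f * homothety r.
Proof. by apply: endoP => m; rewrite /= linearZ. Qed.

Variables (x y : R) (n : nat) (v : 'I_n -> M) (c : 'I_n -> R).
Implicit Types m : M.
Hypothesis dec : decomposed x y v c.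

Lemma dcoef_exists m : exists r, m = \sum_(i < n) r i *: v i.
Proof. by case: dec => -[_ _ gen] _; apply: gen. Qed.
(** Coordinates picked by choice: they are linear in m only modulo [c i]. *)
Definition dcoef (m : M) : 'I_n -> R := sval (cid (dcoef_exists m)).

Lemma dcoefE m : m = \sum_i dcoef m i *: v i.
Proof. exact: svalP (cid (dcoef_exists m)). Qed.

Lemma dcoef_unique r s i :
  \sum_i r i *: v i = \sum_i s i *: v i -> dv (c i) (r i - s i).
Proof.
move=> rs; apply: (dec.2 (fun i => r i - s i)).
under eq_bigr do rewrite scalerBl.
by rewrite sumrB rs subrr.
Qed.

Lemma dv_scale i r (m : M) : c i *: m = 0 -> dv (c i) r -> r *: m = 0.
Proof. by move=> cm [s ->]; rewrite mulrC -scalerA cm scaler0. Qed.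

Lemma dec_cv i : c i *: v i = 0.
Proof. by case: dec => -[]. Qed.

Lemma dcoef_linear a m m' i :
  dv (c i) (dcoef (a *: m + m') i - (a * dcoef m i + dcoef m' i)).
Proof.
apply: (@dcoef_unique _ (fun i => a * dcoef m i + dcoef m' i)).
rewrite -dcoefE {1}[m]dcoefE {1}[m']dcoefE scaler_sumr -big_split.
by apply: eq_bigr => j _; rewrite scalerDl scalerA.
Qed.

Lemma dcoef_basis i j : dv (c i) (dcoef (v j) i - (i == j)%:R).
Proof.
apply: (@dcoef_unique _ (fun i => (i == j)%:R)).
rewrite -dcoefE (bigD1 j) //= eqxx scale1r big1 ?addr0 // => k /negPf ->.
by rewrite scale0r.
Qed.

Lemma scale_congr i r s (m : M) : c i *: m = 0 -> dv (c i) (r - s) -> r *: m = s *: m.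
Proof. by move=> cm /(dv_scale cm) /eqP; rewrite scalerBl subr_eq0 => /eqP. Qed.

Lemma eps_linear i m : c i *: m = 0 -> linear (fun m' => dcoef m' i *: m).
Proof.
move=> cm a m1 m2; rewrite scalerA -scalerDl; apply: scale_congr cm _.
exact: dcoef_linear.
Qed.

(* v i |-> m and v j |-> 0 for j != i; junk value 0 unless c i annihilates m. *)
Definition eps i (m : M) : endo M :=
  if pselect (c i *: m = 0) is left cm then mklin (eps_linear cm) else 0.

Lemma epsE i m m' : c i *: m = 0 -> eps i m m' = dcoef m' i *: m.
Proof. by move=> cm; rewrite /eps; case: pselect. Qed.

Lemma eps_v i m : c i *: m = 0 -> eps i m (v i) = m.
Proof.
move=> cm; rewrite epsE // -[RHS]scale1r; apply: (scale_congr cm).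
by have := dcoef_basis i i; rewrite eqxx.
Qed.

Lemma eps_vj i j m : i != j -> c i *: m = 0 -> eps i m (v j) = 0.
Proof.
move=> ij cm; rewrite epsE // -[RHS](scale0r m); apply: (scale_congr cm).
by have := dcoef_basis i j; rewrite (negPf ij).
Qed.

Lemma endo_ann i (f : endo M) m : c i *: m = 0 -> c i *: f m = 0.
Proof. by move=> cm; rewrite -linearZ cm linear0. Qed.

Lemma eps_lin i (f : endo M) m m' : c i *: m = 0 -> c i *: m' = 0 ->
  eps i (f m + m') = f * eps i m + eps i m'.
Proof.
move=> cm cm'; apply: endoP => p /=.
have cfm := endo_ann f cm.
rewrite !epsE //; last by rewrite scalerDr cfm cm' addr0.
by rewrite scalerDr linearZ.
Qed.

Lemma eps0 i : eps i 0 = 0.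
Proof. by apply: endoP => p; rewrite epsE ?scaler0. Qed.

Lemma eps_mul i (f : endo M) m : c i *: m = 0 -> eps i (f m) = f * eps i m.
Proof.
by move=> cm; rewrite -[f m]addr0 eps_lin ?scaler0 // eps0 addr0.
Qed.

Lemma epsD i m m' : c i *: m = 0 -> c i *: m' = 0 ->
  eps i (m + m') = eps i m + eps i m'.
Proof. by move=> cm cm'; rewrite -{1}[m]/((1 : endo M) m) eps_lin // mul1r. Qed.

Lemma epsZ i r m : c i *: m = 0 -> eps i (r *: m) = homothety r * eps i m.
Proof. by move=> cm; rewrite -eps_mul. Qed.

Lemma eps_comp i j m m' : c i *: m = 0 -> c j *: m' = 0 ->
  eps j m' * eps i m = eps i (dcoef m j *: m').
Proof. by move=> cm cm'; rewrite -eps_mul // epsE. Qed.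

Definition idem i := eps i (v i).

Lemma sum_idem : \sum_i idem i = 1.
Proof.
apply: endoP => m; rewrite [RHS](dcoefE m) [in LHS](dcoefE m) !linear_sum.
have sumE (I : Type) (s : seq I) (F : I -> endo M) p :
    (\sum_(i <- s) F i) p = \sum_(i <- s) F i p.
  by elim/big_rec2: _ => // i a f _ <-.
apply: eq_bigr => i _; rewrite linearZ /=; congr (_ *: _).
rewrite sumE (bigD1 i) //= eps_v ?dec_cv // big1 ?addr0 // => j ji.
by rewrite eps_vj ?dec_cv.
Qed.

End EndomorphismModule.

(** * Direct sums of indecomposable projectives *)

Section FiniteSums.
Variables (V : nmodType) (T : eqType).

Lemma sum_support (F : T -> V) (s1 s2 : seq T) : uniq s1 -> uniq s2 ->
  (forall t, t \notin s1 -> F t = 0) -> (forall t, t \notin s2 -> F t = 0) ->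
  \sum_(t <- s1) F t = \sum_(t <- s2) F t.
Proof.
move=> u1 u2 F1 F2.
have E s : \sum_(t <- s) F t = \sum_(t <- filter (fun t => F t != 0) s) F t.
  rewrite big_filter [LHS](bigID (fun t => F t != 0)) /= [X in _ + X]big1 ?addr0 //.
  by move=> t /negPn/eqP.
rewrite (E s1) (E s2); apply: perm_big.
apply: uniq_perm; rewrite ?filter_uniq // => t; rewrite !mem_filter.
have [//|Ft] := eqVneq (F t) 0; rewrite /=.
have [_|/F1/eqP] := boolP (t \in s1); last by rewrite (negPf Ft).
by have [//|/F2/eqP] := boolP (t \in s2); rewrite (negPf Ft).
Qed.

Lemma sum_delta (s : seq T) t0 (m : V) : uniq s -> t0 \in s ->
  \sum_(t <- s) (if t == t0 then m else 0) = m.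
Proof.
move=> us t0s; rewrite (bigD1_seq t0) //= eqxx big1 ?addr0 // => t /negPf ->//.
Qed.

End FiniteSums.

Section FreeModules.
Variables (R : comNzRingType) (M : lmodType R) (x y : R) (n : nat).
Variables (v : 'I_n -> M) (c : 'I_n -> R).
Hypothesis dec : decomposed x y v c.
Local Notation S := (endo M).
Local Notation eps := (eps dec).
Local Notation co := (dcoef dec).

Section Family.
Variables (T : choiceType) (tau : T -> 'I_n).

(* The direct sum over t of the left ideals End M * idem (tau t), each identified with
   the submodule of M annihilated by c (tau t). *)
Definition fs_mem (f : T -> emod M) : Prop :=
  (exists s : seq T, forall t, t \notin s -> f t = 0) /\
  forall t, c (tau t) *: (f t : M) = 0.

Lemma fs_mem0 : fs_mem 0.
Proof. by split=> [|t]; [exists [::]|apply: scaler0]. Qed.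

Lemma fs_mem_lin (a : S) f g : fs_mem f -> fs_mem g -> fs_mem (a *: f + g).
Proof.
move=> [[s fs] fc] [[r gr] gc]; split=> [|t].
  exists (s ++ r) => t; rewrite mem_cat negb_or => /andP[/fs fs0 /gr gr0].
  have -> : (a *: f + g) t = a *: f t + g t by [].
  by rewrite fs0 gr0 scaler0 addr0.
have -> : (a *: f + g) t = (a (f t) : M) + (g t : M) by [].
by rewrite scalerDr gc addr0 endo_ann.
Qed.

Definition fs_sub := @Submodule S (T -> emod M) fs_mem fs_mem0 fs_mem_lin.
Definition fs : lmodType S := subm fs_sub.
Definition ev (f : fs) (t : T) : M := sm_incl fs_sub f t.

Lemma ev_linear a f g t : ev (a *: f + g) t = a (ev f t) + ev g t.
Proof. by rewrite /ev linearP. Qed.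
Lemma evD f g t : ev (f + g) t = ev f t + ev g t.
Proof. by rewrite /ev linearD. Qed.
Lemma evZ a f t : ev (a *: f) t = a (ev f t).
Proof. by rewrite /ev linearZ. Qed.
Lemma ev0 t : ev 0 t = 0.
Proof. by rewrite /ev linear0. Qed.
Lemma ev_sum (I : Type) (s : seq I) (F : I -> fs) t :
  ev (\sum_(i <- s) F i) t = \sum_(i <- s) ev (F i) t.
Proof. by elim/big_rec2: _ => [|i a f _ <-]; rewrite ?ev0 ?evD. Qed.

Lemma fsP f g : (forall t, ev f t = ev g t) -> f = g.
Proof. by move=> fg; apply: (@sm_incl_inj _ _ fs_sub); apply/funext. Qed.

Lemma ev_mem f : fs_mem (ev f).
Proof. by apply/(sm_inclP fs_sub); exists f. Qed.

Lemma ev_ann f t : c (tau t) *: ev f t = 0.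
Proof. exact: (ev_mem f).2. Qed.

Lemma ev_support f : exists s : seq T, uniq s /\ forall t, t \notin s -> ev f t = 0.
Proof.
have [[s fs0] _] := ev_mem f; exists (undup s); split; first exact: undup_uniq.
by move=> t; rewrite mem_undup; apply: fs0.
Qed.

Lemma fs_ex (f : T -> M) (s : seq T) : (forall t, t \notin s -> f t = 0) ->
  (forall t, c (tau t) *: f t = 0) -> exists g, forall t, ev g t = f t.
Proof.
move=> f0 fc; have /(sm_inclP fs_sub)[g gE] : fs_mem f by split=> //; exists s.
by exists g => t; rewrite /ev gE.
Qed.

(** The condition on m stands under the existential so that [delta] is total; outside it the value
    is junk. *)
Lemma delta_ex t m : exists g, c (tau t) *: m = 0 ->
  forall t', ev g t' = if t' == t then m else 0.
Proof.
have [cm|ncm] := pselect (c (tau t) *: m = 0); last by exists 0.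
have [t'|t'|g gE] := @fs_ex (fun t' => if t' == t then m else 0) [:: t].
- by rewrite inE => /negPf ->.
- by case: eqP => [->|] //; rewrite scaler0.
- by exists g.
Qed.

Definition delta t m : fs := sval (cid (delta_ex t m)).

Lemma ev_delta t m t' : c (tau t) *: m = 0 ->
  ev (delta t m) t' = if t' == t then m else 0.
Proof. by move=> cm; apply: svalP (cid (delta_ex t m)) cm t'. Qed.

Lemma deltaZ (a : S) t m : c (tau t) *: m = 0 -> a *: delta t m = delta t (a m).
Proof.
move=> cm; apply: fsP => t'; rewrite evZ !ev_delta ?endo_ann //.
by case: eqP => // _; rewrite linear0.
Qed.

Lemma eps_delta t m : c (tau t) *: m = 0 ->
  eps (tau t) m *: delta t (v (tau t)) = delta t m.
Proof. by move=> cm; rewrite deltaZ ?(dec_cv dec) // eps_v. Qed.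

Lemma fs_decomp f (s : seq T) : uniq s -> (forall t, t \notin s -> ev f t = 0) ->
  f = \sum_(t <- s) delta t (ev f t).
Proof.
move=> us fs0; apply: fsP => t; rewrite ev_sum.
under eq_bigr => t' _ do rewrite ev_delta ?ev_ann // eq_sym.
have [ts|ts] := boolP (t \in s).
  rewrite (eq_bigr (fun t' => if t' == t then ev f t else 0)) ?sum_delta //.
  by move=> t' _; case: eqP => [->|].
rewrite fs0 // big_seq big1 // => t' t's; case: eqP => // E.
by rewrite -E t's in ts.
Qed.

Variables (N : lmodType S) (p : T -> N).

(** The linear map that sends the generator [delta t (v (tau t))] to [idem (tau t) *: p t]. *)
Definition fs_map_fun (f : fs) : N :=
  \sum_(t <- sval (cid (ev_support f))) eps (tau t) (ev f t) *: p t.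

Lemma fs_map_funE f (s : seq T) : uniq s -> (forall t, t \notin s -> ev f t = 0) ->
  fs_map_fun f = \sum_(t <- s) eps (tau t) (ev f t) *: p t.
Proof.
move=> us fs0; rewrite /fs_map_fun; case: cid => s' /= [us' fs0'].
by apply: sum_support => // t => [/fs0'|/fs0] ->; rewrite eps0 scale0r.
Qed.

Lemma fs_map_linear : linear fs_map_fun.
Proof.
move=> a f g; have [s [us fs0]] := ev_support f; have [r [ur gr0]] := ev_support g.
have uq : uniq (undup (s ++ r)) by exact: undup_uniq.
have f0 t : t \notin undup (s ++ r) -> ev f t = 0.
  by rewrite mem_undup mem_cat negb_or => /andP[/fs0].
have g0 t : t \notin undup (s ++ r) -> ev g t = 0.
  by rewrite mem_undup mem_cat negb_or => /andP[_ /gr0].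
have h0 t : t \notin undup (s ++ r) -> ev (a *: f + g) t = 0.
  by move=> tn; rewrite ev_linear f0 // g0 // linear0 addr0.
rewrite (fs_map_funE uq f0) (fs_map_funE uq g0) (fs_map_funE uq h0).
rewrite scaler_sumr -big_split; apply: eq_bigr => t _ /=.
by rewrite ev_linear eps_lin ?ev_ann // scalerDl scalerA.
Qed.

Definition fs_map : {linear fs -> N} := mklin fs_map_linear.

Lemma fs_mapE f (s : seq T) : uniq s -> (forall t, t \notin s -> ev f t = 0) ->
  fs_map f = \sum_(t <- s) eps (tau t) (ev f t) *: p t.
Proof. exact: fs_map_funE. Qed.

Lemma fs_map_delta t m : c (tau t) *: m = 0 ->
  fs_map (delta t m) = eps (tau t) m *: p t.
Proof.
move=> cm; rewrite (@fs_mapE _ [:: t]) ?big_seq1 ?ev_delta ?eqxx //.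
by move=> t'; rewrite inE ev_delta // => /negPf ->.
Qed.

End Family.

Lemma fs_projective (T : choiceType) (tau : T -> 'I_n) : projective (fs tau).
Proof.
move=> A B g f g_surj.
have /choice[a ga] : forall t, exists a, g a = f (delta tau t (v (tau t))).
  by move=> t; apply: g_surj.
exists (fs_map tau a) => q; have [s [us q0]] := ev_support q.
rewrite (fs_mapE a us q0) linear_sum [in RHS](fs_decomp us q0) linear_sum.
apply: eq_bigr => t _; rewrite linearZ ga -linearZ; congr (f _).
by rewrite eps_delta // ev_ann.
Qed.

End FreeModules.

(** * Submodules of free modules over a principal ideal domain *)

Section WellOrder.
Variables (X : eqType) (le : rel X) (wo : well_order le).

Lemma wo_total : total le.
Proof. by move=> a b; apply: (wo_chainW (withinW (A := predT) wo)). Qed.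

Lemma wo_anti a b : le a b -> le b a -> a = b.
Proof.
by move=> ab ba; apply: (wo_chain_antisymmetric (withinW (A := predT) wo)); rewrite ?ab.
Qed.

Lemma wo_trans a b d : le a b -> le b d -> le a d.
Proof.
move=> ab bd; have [|z [[zin zmin] _]] := @wo (mem [:: a; b; d]).
  by exists a; rewrite inE /= !inE eqxx.
have za : le z a by apply: zmin; rewrite !inE eqxx.
have zb : le z b by apply: zmin; rewrite !inE eqxx orbT.
have zd : le z d by apply: zmin; rewrite !inE eqxx !orbT.
move: zin; rewrite !inE => /or3P[]/eqP E; subst z => //.
  by rewrite (wo_anti ab za).
by rewrite -(wo_anti bd zb).
Qed.

Lemma wo_ind (P : X -> Prop) :
  (forall a, (forall b, b != a -> le b a -> P b) -> P a) -> forall a, P a.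
Proof.
move=> IH a; apply: contrapT => nPa.
have [|z [[zin zmin] _]] := @wo (fun a => `[< ~ P a >]).
  by exists a; apply/asboolP.
move/asboolP: zin; apply; apply: IH => b bz lebz; apply: contrapT => nPb.
have /(wo_anti lebz) E : le z b by apply: zmin; apply/asboolP.
by rewrite E eqxx in bz.
Qed.

Lemma wo_max (P : X -> Prop) (s : seq X) :
  (exists a, a \in s /\ P a) -> exists a, [/\ a \in s, P a &
     forall b, b \in s -> P b -> le b a].
Proof.
elim: s => [[a []//]|a s IHs [b [bs Pb]]].
have [/IHs[d [ds Pd dmax]]|nex] := pselect (exists a, a \in s /\ P a); last first.
  have ba : b = a.
    by move: bs; rewrite inE => /orP[/eqP//|bs]; case: nex; exists b.
  exists a; rewrite inE eqxx -ba; split=> // e; rewrite inE => /orP[/eqP ->|es] Pe.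
    by rewrite ba; have := wo_total a a; rewrite orbb.
  by case: nex; exists e.
have [Pa|nPa] := pselect (P a); last first.
  exists d; rewrite inE ds orbT; split=> // e; rewrite inE => /orP[/eqP ->//|].
  exact: dmax.
have /orP[ad|da] := wo_total a d.
  exists d; rewrite inE ds orbT; split=> // e; rewrite inE => /orP[/eqP ->//|].
  exact: dmax.
exists a; rewrite inE eqxx; split=> // e; rewrite inE => /orP[/eqP ->|es Pe].
  by have := wo_total a a; rewrite orbb.
exact: wo_trans (dmax e es Pe) da.
Qed.

End WellOrder.

Section Combinations.
Variables (R : comNzRingType) (W : lmodType R).

Definition comb (B : W -> Prop) (u : W) : Prop :=
  exists (s : seq W) (r : W -> R),
    [/\ uniq s, forall b, b \in s -> B b & u = \sum_(b <- s) r b *: b].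

Variable B : W -> Prop.

Lemma comb_widen (s s' : seq W) (r : W -> R) : uniq s -> uniq s' -> {subset s <= s'} ->
  \sum_(b <- s) r b *: b = \sum_(b <- s') (if b \in s then r b else 0) *: b.
Proof.
move=> us us' ss'; rewrite [RHS](bigID (mem s)) /= [X in _ + X]big1 ?addr0; last first.
  by move=> b /negPf ->; rewrite scale0r.
rewrite -[RHS]big_filter (perm_big (filter (mem s) s')) /=.
  rewrite !big_filter; apply: eq_bigr => b bs; rewrite ifT //.
apply: uniq_perm; rewrite ?filter_uniq // => b; rewrite mem_filter.
by apply/idP/andP=> [bs|[]//]; split=> //; apply: ss'.
Qed.

Lemma comb_0 : comb B 0.
Proof. by exists [::], (fun=> 0); split=> //; rewrite big_nil. Qed.

Lemma comb_lin a u w : comb B u -> comb B w -> comb B (a *: u + w).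
Proof.
move=> [s [r [us sB ->]]] [s' [r' [us' s'B ->]]].
have uq : uniq (undup (s ++ s')) by apply: undup_uniq.
exists (undup (s ++ s')),
  (fun b => a * (if b \in s then r b else 0) + (if b \in s' then r' b else 0)).
split=> // [b|].
  by rewrite mem_undup mem_cat => /orP[/sB|/s'B].
rewrite (comb_widen r us uq); last by move=> b bs; rewrite mem_undup mem_cat bs.
rewrite (comb_widen r' us' uq); last by move=> b bs; rewrite mem_undup mem_cat bs orbT.
rewrite scaler_sumr -big_split; apply: eq_bigr => b _ /=.
by rewrite scalerDl scalerA.
Qed.

Lemma comb_gen b : B b -> comb B b.
Proof.
move=> Bb; exists [:: b], (fun=> 1); split=> [//|b'|]; last by rewrite big_seq1 scale1r.
by rewrite inE => /eqP ->.
Qed.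

End Combinations.

Section Basis.
Variables (R : comNzRingType) (c : R).
Hypothesis c_prime : forall r s, dv c (r * s) -> dv c r \/ dv c s.
Hypothesis c_principal : forall L : R -> Prop, L 0 ->
  (forall a r s, L r -> L s -> L (a * r + s)) ->
  exists d, L d /\ forall r, L r -> exists a, dv c (r - a * d).
Variables (W : lmodType R) (V : W -> Prop) (X : choiceType) (phi : X -> W -> R).
Hypothesis V0 : V 0.
Hypothesis V_lin : forall a u w, V u -> V w -> V (a *: u + w).
Hypothesis phi_lin : forall t a u w, V u -> V w ->
  dv c (phi t (a *: u + w) - (a * phi t u + phi t w)).
Hypothesis phi_fin : forall u, V u -> exists s : seq X, forall t, t \notin s -> dv c (phi t u).

(* Over the principal ideal domain R / c, a module of finitely supported functions is free;
   its basis consists of elements with prescribed last nonzero coordinate. *)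
Lemma submodule_basis : exists B : W -> Prop,
  [/\ forall b, B b -> V b,
      forall u, V u -> exists w, comb B w /\ forall t, dv c (phi t (u - w)) &
      forall (s : seq W) (r : W -> R), uniq s -> (forall b, b \in s -> B b) ->
        (forall t, dv c (phi t (\sum_(b <- s) r b *: b))) ->
        forall b, b \in s -> dv c (r b)].
Proof.
have phi_Z t a u : V u -> dv c (phi t (a *: u) - a * phi t u).
  move=> Vu; have H0 := phi_lin t 0 V0 V0.
  have := phi_lin t a Vu V0; rewrite addr0 => H.
  have -> : phi t (a *: u) - a * phi t u =
     (phi t (a *: u) - (a * phi t u + phi t 0)) + phi t 0 by ring.
  apply: dvD H _; move: H0; rewrite scaler0 addr0 mul0r add0r => H0.
  have := phi_lin t 1 V0 V0; rewrite scaler0 addr0 mul1r => /dvN.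
  by rewrite opprB -addrA subrr addr0.
have phi_Z' t a u : V u -> dv c (phi t u) -> dv c (phi t (a *: u)).
  by move=> Vu cu; rewrite -[phi t _](subrK (a * phi t u)); apply: dvD (phi_Z _ _ _ Vu) (dvMl _ cu).
have V_Z a u : V u -> V (a *: u) by move=> Vu; rewrite -[a *: u]addr0; apply: V_lin.
have V_D u w : V u -> V w -> V (u + w) by move=> Vu Vw; rewrite -[u]scale1r; apply: V_lin.
have V_sum (s : seq W) (F : W -> W) : (forall b, b \in s -> V (F b)) -> V (\sum_(b <- s) F b).
  by move=> VF; rewrite big_seq; apply: big_ind.
have phi_D t u w : V u -> V w -> dv c (phi t (u + w) - (phi t u + phi t w)).
  by move=> Vu Vw; have := phi_lin t 1 Vu Vw; rewrite scale1r mul1r.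
have phi_sum t (s : seq W) (F : W -> W) : (forall b, b \in s -> V (F b)) ->
    dv c (phi t (\sum_(b <- s) F b) - \sum_(b <- s) phi t (F b)).
  elim: s => [_|b s IHs VF].
    rewrite !big_nil subr0; have := phi_Z t 0 0 V0.
    by rewrite scale0r mul0r subr0.
  have VFs b' : b' \in s -> V (F b') by move=> b's; apply: VF; rewrite inE b's orbT.
  have VFb : V (F b) by apply: VF; rewrite inE eqxx.
  rewrite !big_cons; have := phi_D t _ _ VFb (V_sum _ _ VFs).
  move=> /dvD/(_ (IHs VFs)); congr dv; ring.
have [le wo] := well_ordering_principle X.
pose below t u := V u /\ forall t', ~~ le t' t -> dv c (phi t' u).
(* The leading coefficients at t of the elements of [below t] form an ideal; u attains a generator
   of it modulo c. *)
have gen t : exists u, below t u /\ forall w, below t w -> exists a, dv c (phi t w - a * phi t u).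
  have [||d [[u [bu du]] dgen]] :=
    @c_principal (fun r => exists u, below t u /\ dv c (r - phi t u)).
  - exists 0; split; first by split=> // t' _; have := phi_Z t' 0 0 V0; rewrite scale0r mul0r subr0.
    by have := dvN (phi_Z t 0 0 V0); rewrite scale0r mul0r subr0 sub0r.
  - move=> a r s [u [[Vu bu] ru]] [w [[Vw bw] sw]]; exists (a *: u + w); split.
      split; first exact: V_lin.
      move=> t' t't; rewrite -[phi t' _](subrK (a * phi t' u + phi t' w)).
      apply: dvD (phi_lin _ _ Vu Vw) _.
      by apply: dvD (bw _ t't); apply: dvMl (bu _ t't).
    have -> : a * r + s - phi t (a *: u + w) = a * (r - phi t u) + (s - phi t w)
       - (phi t (a *: u + w) - (a * phi t u + phi t w)) by ring.
    by apply: dvB (phi_lin _ _ Vu Vw); apply: dvD sw; apply: dvMl.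
  exists u; split=> // w bw; have [|a ha] := dgen (phi t w).
    by exists w; split=> //; rewrite subrr; apply: dv0.
  exists a; have -> : phi t w - a * phi t u = (phi t w - a * d) + a * (d - phi t u) by ring.
  by apply: dvD ha _; apply: dvMl.
have [u uP] := choice gen.
have uV t : V (u t) by case: (uP t) => -[].
have u_below t t' : ~~ le t' t -> dv c (phi t' (u t)) by case: (uP t) => -[_ H] _; apply: H.
(* Indices whose ideal of leading coefficients is zero modulo c contribute nothing. *)
pose B b := exists t, b = u t /\ ~ dv c (phi t (u t)).
exists B; split=> [b [t [-> _]] //|w Vw|s r us sB rel b bs].
- have lead w' : V w' -> (forall t, dv c (phi t w')) \/
      exists t, below t w' /\ ~ dv c (phi t w').
    move=> Vw'; have [s ws] := phi_fin Vw'.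
    have [H|nH] := pselect (exists t, t \in s /\ ~ dv c (phi t w')).
      have [t [ts nt tmax]] := wo_max wo H; right; exists t; split=> //; split=> // t' nle.
      apply: contrapT => nt'; move/negP: nle; apply; apply: tmax => //.
      by apply: contrapT => /negP/ws.
    left=> t; apply: contrapT => nt; apply: nH; exists t; split=> //.
    by apply: contrapT => /negP/ws.
  (* Subtracting a multiple of [u t] clears coordinate t modulo c and disturbs none above it, so the
     last nonzero coordinate moves down. *)
  have main : forall t w', below t w' -> exists w0, comb B w0 /\ forall t, dv c (phi t (w' - w0)).
    apply: (wo_ind wo) => t IH w' bw'.
    have [a ha] := (uP t).2 w' bw'.
    (* If [u t] is not in B, coordinate t of w' already vanishes modulo c and nothing is
       subtracted. *)
    pose a' := if pselect (dv c (phi t (u t))) then 0 else a.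
    have combau : comb B (a' *: u t).
      rewrite /a'; case: pselect => ut; first by rewrite scale0r; apply: comb_0.
      rewrite -[_ *: _]addr0; apply: comb_lin (comb_0 _); apply: comb_gen; exists t.
      by split.
    have [Vw' bw''] := bw'.
    pose w1 := (- a') *: u t + w'.
    have Vw1 : V w1 by apply: V_lin.
    have w1t : dv c (phi t w1).
      rewrite -[phi t w1](subrK (- a' * phi t (u t) + phi t w')).
      apply: dvD (phi_lin _ _ (uV t) Vw') _; rewrite addrC mulNr /a'.
      case: pselect => ut //; rewrite mul0r subr0 -[phi t w'](subrK (a * phi t (u t))).
      by apply: dvD ha _; apply: dvMl.
    have w1b t' : ~~ le t' t -> dv c (phi t' w1).
      move=> nle; rewrite -[phi t' w1](subrK (- a' * phi t' (u t) + phi t' w')).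
      apply: dvD (phi_lin _ _ (uV t) Vw') _.
      by apply: dvD (bw'' _ nle); apply: dvMl; apply: u_below.
    have [w0 [Bw0 hw0]] : exists w0, comb B w0 /\ forall t, dv c (phi t (w1 - w0)).
      case: (lead w1 Vw1) => [H|[t' [bt' nt']]].
        by exists 0; split; [apply: comb_0|move=> t'; rewrite subr0].
      have let' : le t' t by apply: contrapT => /negP/w1b.
      apply: (IH t') => //; apply/eqP=> E; apply: nt'; by rewrite E.
    exists (a' *: u t + w0); split.
      by rewrite -[a' *: u t]scale1r; apply: comb_lin.
    move=> t'; have := hw0 t'; congr (dv c (phi t' _)).
    by rewrite /w1 scaleNr opprD addrA [- _ + w']addrC.
  case: (lead w Vw) => [H|[t [bt _]]]; last exact: main bt.
  by exists 0; split; [apply: comb_0|move=> t; rewrite subr0].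
- apply: contrapT => nrb.
  have [tt ttP] : exists tt : W -> X, forall b, b \in s ->
      b = u (tt b) /\ ~ dv c (phi (tt b) (u (tt b))).
    have [t0 _] := sB b bs.
    have /choice[tt ttP] : forall b, exists t, b \in s -> b = u t /\ ~ dv c (phi t (u t)).
      move=> b'; have [/sB[t ht]|nb'] := pselect (b' \in s); first by exists t.
      by exists t0.
    by exists tt.
  have sV b' : b' \in s -> V (r b' *: b').
    by move=> /ttP[-> _]; apply: V_Z; apply: uV.
  (* At the largest leading index t of a term with coefficient nonzero modulo c, all other terms
     vanish modulo c, and primality isolates the coefficient of b1. *)
  have [|t [/mapP[b0 b0s tE] [b1 [b1s b1t nb1]] tmax]] :=
    @wo_max _ _ wo (fun t => exists b', [/\ b' \in s, tt b' = t & ~ dv c (r b')]) (map tt s).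
    by exists (tt b); split; [apply: map_f|exists b].
  have [b1E nb1u] := ttP b1 b1s.
  have H := rel t.
  have {}H : dv c (\sum_(b <- s) phi t (r b *: b)).
    by have := dvB H (phi_sum t s _ sV); rewrite opprB addrC subrK.
  rewrite (bigD1_seq b1) //= in H.
  have H2 : dv c (\sum_(i <- s | i != b1) phi t (r i *: i)).
    rewrite big_seq_cond; apply: dv_sum => i /andP[is_ ib1].
    have [iE niu] := ttP i is_.
    have Vi : V i by rewrite iE.
    have [ri|nri] := pselect (dv c (r i)).
      rewrite -[phi t _](subrK (r i * phi t i)); apply: dvD (phi_Z _ _ _ Vi) _.
      exact: dvM.
    apply: phi_Z' => //; rewrite iE; apply: u_below; apply/negP=> le1.
    have le2 : le (tt i) t by apply: tmax; [apply: map_f|exists i].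
    have E := wo_anti wo le1 le2.
    by move/eqP: ib1; apply; rewrite iE b1E -E b1t.
  have H3 : dv c (phi t (r b1 *: b1)).
    by have := dvB H H2; rewrite addrK.
  have Vb1 : V b1 by rewrite b1E.
  have : dv c (r b1 * phi t b1).
    by have := dvB H3 (phi_Z t (r b1) b1 Vb1); rewrite opprB addrC subrK.
  by case/c_prime => //; rewrite b1E -b1t.
Qed.

End Basis.

(** * Bases modulo the maximal ideal *)

Section ResidueBasis.
Variables (R : comNzRingType) (mm : R -> Prop).
Hypothesis mm_local : forall r, (exists s, s * r = 1) \/ mm r.
Variables (W : lmodType R) (V U : submodule W).
Hypothesis mmV : forall r u, mm r -> V u -> U (r *: u).

(** By [mmV], V modulo U is a vector space over the residue field; a maximal independent set spans
    it. *)
Lemma residue_basis : exists B : W -> Prop,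
  [/\ forall b, B b -> V b,
      forall u, V u -> exists w, comb B w /\ U (u - w) &
      forall (s : seq W) (r : W -> R), uniq s -> (forall b, b \in s -> B b) ->
        U (\sum_(b <- s) r b *: b) -> forall b, b \in s -> mm (r b)].
Proof.
pose P (B : set W) := (forall b, B b -> V b) /\
  forall (s : seq W) (r : W -> R), uniq s -> (forall b, b \in s -> B b) ->
        U (\sum_(b <- s) r b *: b) -> forall b, b \in s -> mm (r b).
have [F FP Ftot|B [[BV Bind] Bmax]] := @Zorn_bigcup W P.
  split=> [b [A FA Ab]|s r us sF Us b bs]; first exact: (FP A FA).1.
  have [A [FA sA]] : exists A, F A /\ forall b, b \in s -> A b.
    have [A0 FA0 _] := sF b bs.
    elim: (s) sF => [_|a l IHl lF]; first by exists A0.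
    have [|A [FA lA]] := IHl; first by move=> b' b'l; apply: lF; rewrite inE b'l orbT.
    have [|A' FA' A'a] := lF a; first by rewrite inE eqxx.
    have [AA'|A'A] := Ftot A A' FA FA'.
      by exists A'; split=> // b'; rewrite inE => /orP[/eqP -> //|/lA/AA'].
    by exists A; split=> // b'; rewrite inE => /orP[/eqP ->|/lA//]; apply: A'A.
  exact: (FP A FA).2 sA Us b bs.
exists B; split=> // u Vu; apply: contrapT => nspan.
have nBu : ~ B u.
  by move=> Bu; apply: nspan; exists u; rewrite subrr; split; [apply: comb_gen|apply: sm_0].
apply: (Bmax (B `|` [set u])%classic).
  split=> [b Bb|]; first by left.
  by move/(_ u)=> H; apply: nBu; apply: H; right.
split=> [b [/BV//|->//]|s r us sB Us].
have [ius|nus] := boolP (u \in s); last first.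
  apply: Bind => // b bs; case: (sB b bs) => // bu.
  by rewrite -bu bs in nus.
have sB' b : b \in rem u s -> B b.
  rewrite mem_rem_uniq // inE => /andP[/eqP bu /sB[]//].
rewrite (perm_big _ (perm_to_rem ius)) big_cons in Us.
(* A unit coefficient would express u through B modulo U, against [nspan]. *)
have mmu : mm (r u).
  case: (mm_local (r u)) => // -[t tr]; case: nspan.
  exists (- t *: \sum_(b <- rem u s) r b *: b); split.
    rewrite -[_ *: _]addr0; apply: comb_lin (comb_0 _).
    by exists (rem u s), r; split=> //; apply: rem_uniq.
  have := sm_Z t Us; rewrite scalerDr scalerA tr scale1r.
  by rewrite scaleNr opprK.
have Urem : U (\sum_(b <- rem u s) r b *: b).
  by have := sm_B Us (mmV mmu Vu); rewrite addrC addKr.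
move=> b bs; have [->//|bu] := eqVneq b u.
apply: (Bind _ _ (rem_uniq u us) sB' Urem).
by rewrite mem_rem_uniq // inE bu.
Qed.

End ResidueBasis.

(** * Upper bounds for the global dimension *)

(* Restriction of scalars along the homotheties R -> End M. *)
Definition resm (R : comNzRingType) (M : lmodType R) (K : lmodType (endo M)) : Type := K.

Section Restriction.
Variables (R : comNzRingType) (M : lmodType R) (K : lmodType (endo M)).

HB.instance Definition _ := GRing.Zmodule.copy (resm K) K.

Definition resm_scale (r : R) (k : resm K) : resm K := homothety M r *: (k : K).

Lemma resm_scaleA r s k : resm_scale r (resm_scale s k) = resm_scale (r * s) k.
Proof. by rewrite /resm_scale homothetyM scalerA. Qed.
Lemma resm_scale1 : left_id 1 resm_scale.
Proof. by move=> k; rewrite /resm_scale homothety1 scale1r. Qed.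
Lemma resm_scaleDr : right_distributive resm_scale +%R.
Proof. by move=> r k l; apply: scalerDr. Qed.
Lemma resm_scaleDl k : {morph resm_scale^~ k : r s / r + s}.
Proof. by move=> r s; rewrite /resm_scale homothetyD scalerDl. Qed.

HB.instance Definition _ := GRing.Zmodule_isLmodule.Build R (resm K)
  resm_scaleA resm_scale1 resm_scaleDr resm_scaleDl.

Lemma resmZ r (k : resm K) : r *: k = homothety M r *: (k : K).
Proof. by []. Qed.

Lemma resm_sub_lin (W : submodule K) (a : R) (u w : resm K) :
  W u -> W w -> W (a *: u + w).
Proof. exact: sm_lin. Qed.
Definition resm_sub (W : submodule K) :=
  @Submodule R (resm K) W (sm_0 W) (@resm_sub_lin W).

End Restriction.

(** Sums in [fs_map] are indexed by T, while [comb] and independence take coefficients indexed by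
    the elements themselves; this passes from one to the other. *)
Lemma extend_along (T K : eqType) (A : Type) (a0 : A) (q : T -> K) (F : T -> A) (s : seq T) :
  {in s &, injective q} -> exists r : K -> A, forall t, t \in s -> r (q t) = F t.
Proof.
move=> q_inj.
have /choice[r rP] : forall b, exists a, forall t, t \in s -> q t = b -> a = F t.
  move=> b; have [[t [ts <-]]|nt] := pselect (exists t, t \in s /\ q t = b).
    by exists (F t) => t' t's /q_inj -> .
  by exists a0 => t ts tb; case: nt; exists t.
by exists r => t ts; apply: rP.
Qed.

Section Resolutions.
Variables (R : comNzRingType) (M : lmodType R) (x y : R) (n : nat).
Variables (v : 'I_n -> M) (c : 'I_n -> R).
Hypotheses (xyP : nodal x y) (dec : decomposed x y v c).
Local Notation S := (endo M).
Local Notation eps := (eps dec).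
Local Notation co := (dcoef dec).
Local Notation idem := (idem dec).
Local Notation hom := (homothety M).
Implicit Types (N K : lmodType S) (m : M).

Lemma dec_c i : [\/ c i = 0, c i = x | c i = y].
Proof.
by case: dec => -[/(_ i)]; rewrite !inE => /or3P[]/eqP -> _ _ _; constructor.
Qed.

Lemma dcoef_ann a m i : a *: m = 0 -> dv (c i) (a * co m i).
Proof.
move=> am; rewrite -[a * _]subr0.
apply: (@dcoef_unique _ _ _ _ _ _ _ dec (fun i => a * co m i) (fun=> 0)).
rewrite [RHS]big1 => [|j _]; last exact: scale0r.
transitivity (a *: \sum_j co m j *: v j); last by rewrite -dcoefE.
by rewrite scaler_sumr; apply: eq_bigr => j _; rewrite scalerA.
Qed.

Lemma dcoef0 i : dv (c i) (co 0 i).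
Proof. by rewrite -[co 0 i]mul1r; apply: dcoef_ann; rewrite scaler0. Qed.

Lemma dcoef_eq0 m : (forall i, dv (c i) (co m i)) -> m = 0.
Proof.
move=> H; rewrite (dcoefE dec m) big1 // => i _.
exact: (dv_scale (dec_cv dec i)).
Qed.

Lemma dcoefZ_basis r i : dv (c i) (co (r *: v i) i - r).
Proof.
have := dcoef_linear dec r (v i) 0 i; rewrite addr0 => H.
have H0 := dcoef0 i; have H1 := dcoef_basis dec i i; rewrite eqxx in H1.
have -> : co (r *: v i) i - r = (co (r *: v i) i - (r * co (v i) i + co 0 i))
   + (r * (co (v i) i - 1) + co 0 i) by ring.
by apply: dvD H _; apply: dvD H0; apply: dvMl.
Qed.

Lemma dv_dcoefZ_basis r i : dv (c i) (co (r *: v i) i) -> dv (c i) r.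
Proof. by move/dvB/(_ (dcoefZ_basis r i)); rewrite opprB addrC subrK. Qed.

Lemma nd_neq0 : [/\ x <> 0, y <> 0 & x <> y].
Proof.
split=> E.
- by case: (br_pow (nd_x xyP) (n := 1)); rewrite expr1 E; apply: dv0.
- by case: (br_pow (nd_y xyP) (n := 1)); rewrite expr1 E; apply: dv0.
- by case: (br_pow (nd_x xyP) (n := 1)); rewrite expr1 E; apply: dvr.
Qed.

Lemma c_prime i : c i != 0 -> forall r s, dv (c i) (r * s) -> dv (c i) r \/ dv (c i) s.
Proof.
case: (dec_c i) => -> => [/eqP//|_|_] r s; first exact: nd_dvM (nodal_sym xyP) _ _.
exact: nd_dvM xyP _ _.
Qed.

Lemma c_principal i : c i != 0 -> forall L : R -> Prop, L 0 ->
  (forall a r s, L r -> L s -> L (a * r + s)) ->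
  exists d, L d /\ forall r, L r -> exists a, dv (c i) (r - a * d).
Proof.
case: (dec_c i) => -> => [/eqP//|_|_]; last exact: (nd_principal xyP).
exact: (nd_principal (nodal_sym xyP)).
Qed.

Lemma c_self i r : c i != 0 -> c i * r = 0 -> dv (c i) r -> r = 0.
Proof.
case: (dec_c i) => -> => [/eqP//|_|_] h1 h2.
  by apply: (nd_dvxy xyP) => //; apply/(nd_ann xyP).
by apply: (nd_dvxy xyP) => //; apply/(nd_ann (nodal_sym xyP)).
Qed.

Lemma c_distinct i j r : c i != 0 -> c j != 0 -> c i != c j ->
  dv (c j) (c i * r) -> dv (c j) r.
Proof.
move=> ci cj cij /(c_prime cj)[] // H; exfalso; move: H ci cj cij.
case: (dec_c i) => ->; case: (dec_c j) => ->; rewrite ?eqxx //.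
  by have := br_pow (nd_x xyP) (n := 1); rewrite expr1.
by have := br_pow (nd_y xyP) (n := 1); rewrite expr1.
Qed.

Lemma dec_soc0 m : x *: m = 0 -> y *: m = 0 -> m = 0.
Proof.
move=> xm ym; apply: dcoef_eq0 => i.
have := dcoef_ann i xm; have := dcoef_ann i ym; case: (dec_c i) => -> h1 h2.
- apply/dv0P; apply: (nd_dvxy xyP); first by apply/(nd_ann (nodal_sym xyP))/dv0P.
  by apply/(nd_ann xyP)/dv0P.
- by apply: (nd_dvx (nodal_sym xyP)).
- exact: (nd_dvx xyP).
Qed.

Lemma ev_hom (T : choiceType) (tau : T -> 'I_n) r (f : fs M c tau) t :
  ev (hom r *: f) t = r *: ev f t.
Proof. by rewrite evZ. Qed.

Lemma idem_expand N (k : N) : k = \sum_i idem i *: k.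
Proof. by rewrite -scaler_suml sum_idem scale1r. Qed.

Lemma fs_cover N : exists (T : choiceType) (tau : T -> 'I_n) (g : {linear fs M c tau -> N}),
  forall k, exists f, g f = k.
Proof.
exists ('I_n * N)%type, fst, (fs_map dec fst snd) => k.
exists (\sum_i delta c fst (i, k) (v i)); rewrite linear_sum [RHS]idem_expand.
by apply: eq_bigr => i _; rewrite fs_map_delta //= (dec_cv dec).
Qed.

(** The first syzygy of any module can be taken inside some [fs], and the embedding supplies
    coordinates. *)
Lemma gldim_le_succ d :
  (forall (T : choiceType) (tau : T -> 'I_n) K (kap : {linear K -> fs M c tau}),
     injective kap -> pdi d K) -> gldim_le S d.+1.
Proof.
move=> H N; apply: pd_le_of_pdi.
have [T [tau [g g_surj]]] := fs_cover N.
exists (fs M c tau), (subm (kerm g)), (sm_incl _), g; split.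
- exact: fs_projective dec _ tau.
- exact: ses_ker.
- exact: H (@sm_incl_inj _ _ _).
Qed.


Section TorsionPart.
Variables (X : choiceType) (sigma : X -> 'I_n) (K : lmodType S).
Variables (kap : {linear K -> fs M c sigma}) (kap_inj : injective kap).

(** The components of an element fixed by [idem i] are multiples of [v i]. So its i-th coordinates
    under kap determine it, and they embed [idem i *: K] in the finitely supported functions with
    values in R / c i. *)
Lemma idem_basis i : c i != 0 -> exists B : K -> Prop,
  [/\ forall b, B b -> idem i *: b = b,
      forall k, idem i *: k = k -> comb (W := resm K) B k &
      forall (s : seq K) (r : K -> R), uniq s -> (forall b, b \in s -> B b) ->
        \sum_(b <- s) hom (r b) *: b = 0 -> forall b, b \in s -> dv (c i) (r b)].
Proof.
move=> ci.
pose V (k : resm K) := idem i *: (k : K) = k.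
pose phi (t : X) (k : resm K) := co (ev (kap k) t) i.
have V0 : V 0 by apply: scaler0.
have V_lin a u w : V u -> V w -> V (a *: u + w).
  move=> Vu Vw; rewrite /V scalerDr Vw; congr (_ + w).
  by rewrite resmZ scalerA -homothetyC -scalerA Vu.
have phi_lin t a u w : V u -> V w ->
    dv (c i) (phi t (a *: u + w) - (a * phi t u + phi t w)).
  by move=> _ _; rewrite /phi resmZ linearP ev_linear; apply: dcoef_linear.
have phi_fin u : V u -> exists s : seq X, forall t, t \notin s -> dv (c i) (phi t u).
  move=> _; have [s [_ s0]] := ev_support (kap u); exists s => t /s0.
  by rewrite /phi => ->; apply: dcoef0.
have V_zero k : V k -> (forall t, dv (c i) (phi t k)) -> k = 0.
  move=> Vk H; apply: kap_inj; rewrite linear0; apply: fsP => t; rewrite ev0.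
  rewrite -Vk linearZ evZ epsE ?(dec_cv dec) //.
  exact: dv_scale (dec_cv dec i) (H t).
have [B [BV span ind]] := submodule_basis (c_prime ci) (c_principal ci) V0 V_lin phi_lin phi_fin.
exists B; split=> [b /BV//|k Vk|s r us sB rel].
  have [w [Bw kw]] := span k Vk.
  have Vw : V w.
    case: Bw => s [r [us sB ->]]; rewrite big_seq.
    apply: big_ind => // [u1 u2 V1 V2|b bs]; first by rewrite -[u1]scale1r; apply: V_lin.
    by rewrite -[_ *: _]addr0; apply: V_lin => //; apply/BV/sB.
  have Vkw : V (k - w) by rewrite addrC -scaleN1r; apply: V_lin.
  by have /eqP := V_zero _ Vkw kw; rewrite subr_eq0 => /eqP ->.
apply: ind us sB _ => t; rewrite /phi.
have -> : \sum_(b <- s) r b *: (b : resm K) = 0 :> K by exact: rel.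
by rewrite linear0 ev0; apply: dcoef0.
Qed.

Definition rep (i : 'I_n) : 'I_n := odflt i [pick j | c j == c i].

Lemma c_rep i : c (rep i) = c i.
Proof. by rewrite /rep; case: pickP => [j /eqP|/(_ i)] //=. Qed.

Lemma rep_eq i j : c i = c j -> rep i = rep j.
Proof.
rewrite /rep => cij; rewrite cij.
by case: pickP => [//|/(_ j)]; rewrite eqxx.
Qed.

(* As K embeds in a direct sum of projectives, idem i *: K is free over the principal ideal
   domain R / c i; bases for one i in each isomorphism class generate U. *)
Lemma torsion_part : exists (U : lmodType S) (u : {linear U -> K}),
  [/\ projective U, injective u & forall i k, c i != 0 -> exists a, u a = idem i *: k].
Proof.
have /choice[B BP] : forall i, exists B : K -> Prop, c i != 0 ->
  [/\ forall b, B b -> idem i *: b = b,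
      forall k, idem i *: k = k -> comb (W := resm K) B k &
      forall (s : seq K) (r : K -> R), uniq s -> (forall b, b \in s -> B b) ->
        \sum_(b <- s) hom (r b) *: b = 0 -> forall b, b \in s -> dv (c i) (r b)].
  move=> i; have [ci|ci] := eqVneq (c i) 0; first by exists (fun=> True).
  by have [B HB] := idem_basis ci; exists B.
pose good : pred ('I_n * K) := fun p => `[< [/\ p.1 = rep p.1, c p.1 != 0 & B p.1 p.2] >].
pose T : choiceType := {p : 'I_n * K | good p}.
pose tau (t : T) := (val t).1.
pose q (t : T) := (val t).2.
have tauP t : [/\ tau t = rep (tau t), c (tau t) != 0 & B (tau t) (q t)].
  exact/asboolP/(valP t).
exists (fs M c tau), (fs_map dec tau q); split.
- exact: fs_projective dec _ tau.
- suff ker0 f : fs_map dec tau q f = 0 -> f = 0.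
    move=> f g E; apply/eqP; rewrite -subr_eq0; apply/eqP/ker0.
    by rewrite linearB E subrr.
  move=> f0; apply: fsP => t0; rewrite ev0.
  (* Independence of [B j] controls only the j-th coordinates of a kernel element; the others are
     moved to position j below. *)
  have main g j : fs_map dec tau q g = 0 -> j = rep j -> c j != 0 ->
      forall t, dv (c j) (co (ev g t) j).
    move=> g0 jrep cj.
    (* Such a component is killed by the other branch variable, a nonzerodivisor modulo [c j]. *)
    have off t : tau t != j -> dv (c j) (co (ev g t) j).
      move=> tj; have [trep ct _] := tauP t.
      apply: (c_distinct ct cj); last exact: dcoef_ann (ev_ann g t).
      by apply: contra tj => /eqP/rep_eq; rewrite -trep -jrep => ->.
    have [s [us s0]] := ev_support g.
    have sumE : \sum_(t <- s | tau t == j) hom (co (ev g t) j) *: q t = 0.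
      have E : 0 = idem j *: fs_map dec tau q g by rewrite g0 scaler0.
      rewrite [RHS]E (fs_mapE dec q us s0) scaler_sumr.
      rewrite [RHS](bigID (fun t => tau t == j)) /= [X in _ + X]big1 ?addr0; last first.
        move=> t /off H; rewrite scalerA eps_comp ?ev_ann ?(dec_cv dec) //.
        by rewrite (dv_scale (dec_cv dec j) H) eps0 scale0r.
      apply: eq_bigr => t /eqP tj; have [_ ct Bt] := tauP t.
      have Bq : idem j *: q t = q t by rewrite -tj; case: (BP _ ct) => Bid _ _; apply: Bid.
      rewrite scalerA eps_comp ?ev_ann ?(dec_cv dec) // tj epsZ ?(dec_cv dec) //.
      by rewrite -scalerA -/(idem j) Bq.
    move=> t; have [/eqP tj|/off//] := boolP (tau t == j).
    have [ts|/s0 ->] := boolP (t \in s); last exact: dcoef0.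
    pose s1 := [seq t <- s | tau t == j].
    have q_inj : {in s1 &, injective q}.
      move=> a b; rewrite !mem_filter => /andP[/eqP aj _] /andP[/eqP bj _] ab.
      by apply: val_inj; rewrite [LHS]surjective_pairing [RHS]surjective_pairing;
        rewrite -/(tau a) -/(tau b) aj bj -/(q a) ab.
    have [r rq] := extend_along 0 (fun t => co (ev g t) j) q_inj.
    have [_ _ ind] := BP j cj.
    have ts1 : t \in s1 by rewrite mem_filter tj eqxx.
    rewrite -(rq t ts1); apply: (ind (map q s1) r); last exact: map_f.
    + by rewrite map_inj_in_uniq // filter_uniq.
    + move=> b /mapP[a]; rewrite mem_filter => /andP[/eqP aj _] ->.
      by have [_ _] := tauP a; rewrite aj.
    + rewrite big_map -[RHS]sumE -[RHS]big_filter; apply: eq_big_seq => a as1.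
      by rewrite rq.
  pose m := ev f t0; pose i := tau t0; have [irep ci _] := tauP t0.
  (* If [c l = 0], coordinate l is moved to position i; it is then divisible by [c i] and killed by
     it, hence zero. Otherwise it is moved to the representative of its own class. *)
  apply: dcoef_eq0 => l; have [cl|cl] := eqVneq (c l) 0.
    have cvi : c l *: v i = 0 by rewrite cl scale0r.
    have g0 : fs_map dec tau q (eps l (v i) *: f) = 0 by rewrite linearZ_LR f0 scaler0.
    have := main _ i g0 irep ci t0; rewrite evZ epsE // => /dv_dcoefZ_basis H.
    rewrite (_ : co m l = 0); first exact: dv0.
    apply: (c_self ci) => //; apply/dv0P; rewrite -cl.
    exact: dcoef_ann (ev_ann f t0).
  pose j := rep l.
  have cvj : c l *: v j = 0 by rewrite -(c_rep l) (dec_cv dec).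
  have g0 : fs_map dec tau q (eps l (v j) *: f) = 0 by rewrite linearZ_LR f0 scaler0.
  have jrep : j = rep j by apply: rep_eq; rewrite c_rep.
  have cj : c j != 0 by rewrite c_rep.
  have := main _ j g0 jrep cj t0; rewrite evZ epsE // => /dv_dcoefZ_basis.
  by rewrite c_rep.
- move=> i k ci; pose j := rep i.
  have cj : c j != 0 by rewrite c_rep.
  have jrep : j = rep j by apply: rep_eq; rewrite c_rep.
  have civj : c i *: v j = 0 by rewrite -(c_rep i) (dec_cv dec).
  have cjvi : c j *: v i = 0 by rewrite c_rep (dec_cv dec).
  have [Bid span _] := BP j cj.
  (* The summands at i and j are isomorphic: k is carried to j, where B spans, and carried back by
     [eps j (v i)]. *)
  pose k' := eps i (v j) *: k.
  have k'j : idem j *: k' = k'.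
    by rewrite scalerA -eps_mul // eps_v // (dec_cv dec).
  have {}/span [s [r [us sB k'E]]] := k'j.
  pose W := rangem (fs_map dec tau q).
  have Wb b : b \in s -> W b.
    move=> bs; have Bb := sB b bs.
    have gb : good (j, b) by apply/asboolP.
    exists (delta c tau (Sub (j, b) gb : T) (v j)).
    by rewrite fs_map_delta ?(dec_cv dec) // -/(idem j) Bid.
  have Wk' : W k'.
    rewrite k'E big_seq; apply: (sm_sum (W := W)) => b bs.
    by rewrite resmZ; apply: sm_Z; apply: Wb.
  have -> : idem i *: k = eps j (v i) *: k'.
    by rewrite scalerA -eps_mul // eps_v.
  exact: (sm_Z (W := W)).
Qed.

End TorsionPart.

End Resolutions.

Section UpperBounds.
Variables (R : comNzRingType) (M : lmodType R) (x y : R) (n : nat).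
Variables (v : 'I_n -> M) (c : 'I_n -> R).
Hypotheses (xyP : nodal x y) (dec : decomposed x y v c).
Local Notation S := (endo M).
Local Notation eps := (eps dec).
Local Notation co := (dcoef dec).
Local Notation idem := (idem dec).
Local Notation hom := (homothety M).
Implicit Types (N K : lmodType S) (m : M).

Lemma submodule_full K (W : submodule K) :
  (forall i k, W (idem i *: k)) -> forall k, W k.
Proof. by move=> H k; rewrite (idem_expand dec k); apply: sm_sum. Qed.

Lemma gldim_le1_hereditary : (forall i, c i != 0) -> gldim_le S 1.
Proof.
move=> c0; apply: (gldim_le_succ dec) => X sigma K kap kap_inj.
have [U [u [Up u_inj uP]]] := torsion_part xyP dec kap_inj.
apply: (pdi_iso (n := 0) u_inj) Up => k.
by apply: (submodule_full (W := rangem u)) => i l; apply: uP.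
Qed.

(** All summands with [c i = 0] are isomorphic to the one at w. *)
Lemma submodule_gen K (W : submodule K) w : c w = 0 ->
  (forall i k, c i != 0 -> W (idem i *: k)) ->
  (forall k, idem w *: k = k -> W k) -> forall k, W k.
Proof.
move=> cw Wt Ww; apply: submodule_full => i k.
have [ci|ci] := eqVneq (c i) 0; last exact: Wt.
have civ : c i *: v w = 0 by rewrite ci scale0r.
have cwv : c w *: v i = 0 by rewrite cw scale0r.
have -> : idem i *: k = eps w (v i) *: (eps i (v w) *: k).
  by rewrite scalerA -eps_mul // eps_v.
apply: sm_Z; apply: Ww.
by rewrite scalerA -eps_mul // eps_v // (dec_cv dec).
Qed.

(** As [c i] kills m, the map v_w |-> m factors through the summand at i. *)
Lemma torsion_range K (W : submodule K) w i m k : c w = 0 -> c i != 0 ->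
  (forall k, W (idem i *: k)) -> c i *: m = 0 -> W (eps w m *: k).
Proof.
move=> cw ci Wi cm.
have -> : eps w m = eps i m * (idem i * eps w (v i)).
  rewrite -eps_mul ?cw ?scale0r // eps_v ?(dec_cv dec) //.
  by rewrite -eps_mul ?cw ?scale0r // eps_v.
by rewrite -scalerA; apply: sm_Z; rewrite -scalerA; apply: Wi.
Qed.

Section FreeOnSubset.
Variables (K : lmodType S) (w : 'I_n) (cw : c w = 0) (B : K -> Prop).
Hypothesis BP : forall b, B b -> idem w *: b = b.
Let T : choiceType := {b : K | `[< B b >]}.
Let tau (t : T) : 'I_n := w.
Let phi : {linear fs M c tau -> K} := fs_map dec tau (fun t => val t).

Lemma cw_ann m : c w *: m = 0. Proof. by rewrite cw scale0r. Qed.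

Lemma val_in_B (t : T) : B (val t). Proof. exact/asboolP/(valP t). Qed.

Lemma comb_range (k : K) : comb (W := resm K) B k -> exists p, phi p = k.
Proof.
case=> s [r [us sB ->]]; rewrite big_seq.
apply: (sm_sum (W := rangem phi)) => b bs.
have Bb : `[< B b >] by apply/asboolP; apply: sB.
rewrite resmZ; apply: sm_Z; exists (delta c tau (Sub b Bb : T) (v w)).
by rewrite fs_map_delta ?cw_ann //= BP //; apply: sB.
Qed.

(** Acting by [eps l (v w)] turns the l-th coordinates of p into coefficients on B, so independence
    of B can be applied one coordinate at a time. *)
Lemma phi_coef (p : fs M c tau) l : c l = 0 ->
  exists (s : seq K) (r : K -> R),
    [/\ uniq s, forall b, b \in s -> B b,
        eps l (v w) *: phi p = \sum_(b <- s) hom (r b) *: b &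
        forall t, ev p t = 0 \/ (val t \in s /\ r (val t) = co (ev p t) l)].
Proof.
move=> cl; have clw m : c l *: m = 0 by rewrite cl scale0r.
have [s [us s0]] := ev_support p.
have val_inj' : {in s &, injective (val : T -> K)} by move=> a b _ _; apply: val_inj.
have [r rq] := extend_along 0 (fun t => co (ev p t) l) val_inj'.
exists (map val s), r; split.
- by rewrite map_inj_in_uniq.
- by move=> b /mapP[t _ ->]; apply: val_in_B.
- rewrite (fs_mapE dec _ us s0) scaler_sumr big_map; apply: eq_big_seq => t ts.
  rewrite rq // scalerA eps_comp ?cw_ann ?clw // epsZ ?cw_ann //.
  by rewrite -scalerA; congr (_ *: _); apply: BP; apply: val_in_B.
- move=> t; have [ts|/s0] := boolP (t \in s); [right|by left].
  by split; [apply: map_f|apply: rq].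
Qed.

End FreeOnSubset.

(** In a free coordinate x a + y b, the term x a is killed by y and y b by x; a torsion coordinate
    goes as a whole to the side that kills it. *)
Lemma split_soc m : (forall l, c l = 0 -> exists a b, co m l = x * a + y * b) ->
  exists m', y *: m' = 0 /\ x *: (m - m') = 0.
Proof.
move=> H.
have xy0 : x * y = 0 := nd_mul xyP.
have /choice[f fP] : forall l, exists a, y *: (a *: v l) = 0 /\ x *: (co m l *: v l - a *: v l) = 0.
  move=> l; have := dec_cv dec l; case: (dec_c dec l) => cl; rewrite cl => cv.
  - have [a [b ->]] := H l cl; exists (x * a).
    rewrite -scalerBl addrC addKr !scalerA !mulrA xy0 [y * x]mulrC xy0 !mul0r.
    by rewrite !scale0r.
  - by exists 0; rewrite scale0r subr0 scaler0 scalerA mulrC -scalerA cv scaler0.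
  - by exists (co m l); rewrite subrr scaler0 scalerA mulrC -scalerA cv scaler0.
exists (\sum_l f l *: v l); split.
  by rewrite scaler_sumr big1 // => l _; case: (fP l).
rewrite {1}(dcoefE dec m) -sumrB scaler_sumr big1 // => l _.
by case: (fP l).
Qed.

(** Componentwise, this is the inclusion of the annihilator of [c i] in M, which is the projective
    at w. *)
Lemma fs_incl (T : choiceType) i w : c w = 0 ->
  exists h : {linear fs M c (fun _ : T => i) -> fs M c (fun _ : T => w)},
    (forall f t, ev (h f) t = ev f t) /\
    forall p, (forall t, c i *: ev p t = 0) -> exists f, h f = p.
Proof.
move=> cw.
have /choice[h hE] : forall f : fs M c (fun _ : T => i),
    exists g : fs M c (fun _ : T => w), forall t, ev g t = ev f t.
  move=> f; have [s [_ s0]] := ev_support f.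
  by apply: (fs_ex s0) => t; rewrite cw scale0r.
have h_lin : linear h.
  by move=> a f g; apply: fsP => t; rewrite ev_linear !hE ev_linear.
exists (mklin h_lin); split=> [f t|p py]; first exact: hE.
have [s [_ s0]] := ev_support p.
by have [f fE] := fs_ex (tau := fun _ : T => i) s0 py; exists f; apply: fsP => t; rewrite hE fE.
Qed.

Lemma gldim_le2 al be w : c al = y -> c be = x -> c w = 0 -> gldim_le S 2.
Proof.
move=> cal cbe cw.
have [x0 y0 xy] := nd_neq0 xyP.
have cal0 : c al != 0 by rewrite cal; apply/eqP.
have cbe0 : c be != 0 by rewrite cbe; apply/eqP.
apply: (gldim_le_succ dec) => X sigma K kap kap_inj.
have [U [u [Up u_inj uP]]] := torsion_part xyP dec kap_inj.
pose Uk := rangem u.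
have Ual k : Uk (idem al *: k) by apply: uP.
have Ube k : Uk (idem be *: k) by apply: uP.
have Vl a (k k' : K) : idem w *: k = k -> idem w *: k' = k' ->
    idem w *: (hom a *: k + k') = hom a *: k + k'.
  by move=> Vk Vk'; rewrite scalerDr Vk' scalerA -homothetyC -scalerA Vk.
pose V : submodule (resm K) := @Submodule R (resm K)
  (fun k => idem w *: (k : K) = k) (scaler0 _ _) Vl.
(* On the component at w, multiplication by x factors through the summand R/y and multiplication by
   y through R/x; both land in [Uk]. *)
have mmV r k : (exists a b, r = x * a + y * b) -> V k -> resm_sub Uk (r *: k).
  move=> [a [b ->]] Vk; rewrite resmZ -Vk scalerA -epsZ ?cw ?scale0r // scalerDl.
  rewrite epsD ?cw ?scale0r // scalerDl; apply: (sm_D (W := Uk)).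
    apply: (torsion_range _ cw cal0 Ual).
    by rewrite cal scalerA mulrA [y * x]mulrC (nd_mul xyP) mul0r scale0r.
  apply: (torsion_range _ cw cbe0 Ube).
  by rewrite cbe scalerA mulrA (nd_mul xyP) mul0r scale0r.
have [B [BV span ind]] := residue_basis (nd_local xyP) mmV.
have BP b : B b -> idem w *: b = b by move/BV.
pose T : choiceType := {b : K | `[< B b >]}.
pose phi : {linear fs M c (fun _ : T => w) -> K} := fs_map dec (fun _ : T => w) (fun t => val t).
(* Each basis element gets a component killed by y ([true]) and one killed by x ([false]). Adding
   the two is injective because M has no socle. *)
have jex : forall f : fs M c (fun q : T * bool => if q.2 then al else be),
    exists g : fs M c (fun _ : T => w), forall t, ev g t = ev f (t, true) + ev f (t, false).
  move=> f; have [s [_ s0]] := ev_support f.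
  apply: (@fs_ex _ _ _ _ _ _ _ (map fst s)) => t; last by rewrite cw scale0r.
  by move=> ts; rewrite !s0 ?addr0 //; apply: contra ts => ts; apply/mapP; eexists; eauto.
have [jf jfE] := choice jex.
have j_lin : linear jf.
  move=> a f g; apply: fsP => t; rewrite ev_linear !jfE !ev_linear.
  by rewrite linearD addrACA.
apply: (@pdi_amalgam _ 0 _ _ _ _ u phi (mklin j_lin) Up) => //.
- exact: fs_projective dec _ _.
- move=> f g; rewrite !mklinE => E; apply/eqP; rewrite -subr_eq0; apply/eqP.
  have {E} : jf (f - g) = 0 by rewrite -[jf _]/(mklin j_lin _) linearB /= E subrr.
  move: (f - g) => {g}f E; apply: fsP => -[t b]; rewrite ev0.
  have := congr1 (fun f => ev f t) E; rewrite jfE ev0 => E0.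
  have ft := ev_ann f (t, true); have ff := ev_ann f (t, false).
  rewrite /= cal in ft; rewrite /= cbe in ff.
  have Ef : ev f (t, false) = 0.
    apply: (dec_soc0 xyP dec) => //.
    by have /(congr1 (fun m => y *: m)) := E0; rewrite scalerDr ft add0r scaler0.
  by move: E0; rewrite Ef addr0; case: b => // ->.
- suff gen k : rangem (copair u phi) k by move=> k; have [[a p] <-] := gen k; exists a, p.
  move: k; apply: (@submodule_gen K (rangem (copair u phi)) w cw).
  + move=> i k ci; have [a ua] := uP i k ci; exists (a, 0).
    by rewrite copairE linear0 addr0.
  + move=> k Vk; have [b [Bb [a ua]]] := span k Vk.
    have [p pb] := comb_range cw BP Bb.
    by exists (a, p); rewrite copairE ua pb subrK.
- move=> p; split=> [[a ua]|[f <-]].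
  (* [Uk] is stable under [eps l (v w)], so independence of B modulo U puts the l-th coordinates in
     the maximal ideal. *)
  + have mm t l : c l = 0 -> exists a b, co (ev p t) l = x * a + y * b.
      move=> cl; have [s [r [us sB E tP]]] := phi_coef cw BP p cl.
      case: (tP t) => [->|[ts <-]].
        exists 0, 0; rewrite !mulr0 addr0; apply/dv0P; rewrite -cl.
        exact: dcoef0.
      apply: (ind s r us sB) ts.
      rewrite -[X in resm_sub _ X]/(\sum_(b <- s) hom (r b) *: b) -E -ua.
      by exists (eps l (v w) *: a); rewrite linearZ.
    have /choice[f fP] : forall t, exists m', [/\ y *: m' = 0, x *: (ev p t - m') = 0 &
        ev p t = 0 -> m' = 0].
      move=> t; have [->|/eqP pt] := eqVneq (ev p t) 0.
        by exists 0; rewrite subrr !scaler0.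
      have [m' [ym xm]] := split_soc (mm t).
      by exists m'.
    have [s [_ s0]] := ev_support p.
    pose F (q : T * bool) := if q.2 then f q.1 else ev p q.1 - f q.1.
    have F0 q : q \notin [seq (t, b) | t <- s, b <- [:: true; false]] -> F q = 0.
      move=> qs; have Eq : ev p q.1 = 0.
        apply: s0; apply: contra qs => qs; apply/allpairsP.
        by exists q; rewrite -surjective_pairing; split=> //; case: (q.2); rewrite !inE.
      have [_ _ /(_ Eq) Ef] := fP q.1.
      by rewrite /F Ef Eq subr0; case: (q.2).
    have Fc q : c (if q.2 then al else be) *: F q = 0.
      by rewrite /F; have [? ? _] := fP q.1; case: (q.2); rewrite ?cal ?cbe.
    have [g gE] := fs_ex (tau := fun q : T * bool => if q.2 then al else be) F0 Fc.
    by exists g; apply: fsP => t; rewrite mklinE jfE !gE /F /= addrC subrK.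
  + suff : Uk (phi (jf f)) by [].
    have [s [us s0]] := ev_support (jf f).
    have -> : phi (jf f) = \sum_(t <- s) eps w (ev (jf f) t) *: val t by apply: fs_mapE.
    apply: (sm_sum (W := Uk)) => t _.
    have ft := ev_ann f (t, true); have ff := ev_ann f (t, false).
    rewrite jfE epsD ?cw ?scale0r // scalerDl; apply: sm_D.
      exact: torsion_range _ cw cal0 Ual ft.
    exact: torsion_range _ cw cbe0 Ube ff.
- exact: fs_projective dec _ _.
Qed.

Lemma gldim_le3 al w : c al = y -> c w = 0 -> (forall i, c i <> x) -> gldim_le S 3.
Proof.
move=> cal cw cx.
have [x0 y0 xy] := nd_neq0 xyP.
have cal0 : c al != 0 by rewrite cal; apply/eqP.
have cwm m : c w *: m = 0 by rewrite cw scale0r.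
apply: (gldim_le_succ dec) => X sigma K kap kap_inj.
have [U [u [Up u_inj uP]]] := torsion_part xyP dec kap_inj.
pose Uk := rangem u.
have Ual k : Uk (idem al *: k) by apply: uP.
(* Modulo U this component need not be free over R/x, so all its elements serve as generators; the
   preimage L of U is resolved in turn. *)
pose T : choiceType := {b : K | `[< idem w *: b = b >]}.
pose phi : {linear fs M c (fun _ : T => w) -> K} := fs_map dec (fun _ : T => w) (fun t => val t).
have L0 : Uk (phi 0) by rewrite linear0; apply: sm_0.
have Ll a p q : Uk (phi p) -> Uk (phi q) -> Uk (phi (a *: p + q)).
  by move=> pU qU; rewrite linearP; apply: sm_lin.
pose L := @Submodule S _ (fun p => Uk (phi p)) L0 Ll.
apply: (@pdi_amalgam _ 1 _ _ _ _ u phi (sm_incl L) Up).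
- exact: fs_projective dec _ _.
- exact: u_inj.
- exact: sm_incl_inj.
- suff gen k : rangem (copair u phi) k by move=> k; have [[a p] <-] := gen k; exists a, p.
  move: k; apply: (@submodule_gen K (rangem (copair u phi)) w cw).
  + move=> i k ci; have [a ua] := uP i k ci; exists (a, 0).
    by rewrite copairE linear0 addr0.
  + move=> k Vk; have [p pk] := comb_range cw (fun b H => H)
      (comb_gen (Vk : (fun b => idem w *: b = b) k)).
    by exists (0, p); rewrite copairE linear0 add0r pk.
- by move=> p; apply: (sm_inclP L).
pose evL (p : subm L) t := ev (sm_incl L p) t.
have evL_lin a p q t : evL (a *: p + q) t = a (evL p t) + evL q t.
  by rewrite /evL linearP ev_linear.
have evL_inj p q : (forall t, evL p t = evL q t) -> p = q.
  by move=> H; apply: (@sm_incl_inj _ _ L); apply: fsP.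
(* The part of L where y vanishes is projective, and modulo it L is free over R / x. *)
have [h [hE h_surj]] := @fs_incl T al w cw.
have hL f : L (h f).
  have [s [us s0]] := ev_support (h f); rewrite -[L _]/(Uk (phi _)).
  have -> : phi (h f) = \sum_(t <- s) eps w (ev (h f) t) *: val t by apply: fs_mapE.
  apply: (sm_sum (W := Uk)) => t _; apply: (torsion_range _ cw cal0 Ual).
  by rewrite hE (ev_ann f t).
have [u0 u0E] := corestrict hL.
have u0P p : (exists a, u0 a = p) <-> hom y *: p = 0.
  split=> [[a <-]|yp].
    apply: evL_inj => t; rewrite /evL linear0 ev0 linearZ_LR ev_hom u0E hE -cal.
    exact: ev_ann.
  have [t|f hf] := h_surj (sm_incl L p).
    by rewrite cal -ev_hom -linearZ_LR yp linear0 ev0.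
  by exists f; apply: (@sm_incl_inj _ _ L); rewrite u0E.
pose V (p : resm (subm L)) := idem w *: (p : subm L) = p.
(* For a fixed element p, all [psi t p] vanish modulo x exactly when y kills p, that is, when p lies
   in the image of [u0]. *)
pose psi (t : T) (p : resm (subm L)) := co (evL p t) w.
have V0 : V 0 by apply: scaler0.
have V_lin a p q : V p -> V q -> V (a *: p + q).
  move=> Vp Vq; rewrite /V scalerDr Vq; congr (_ + q).
  by rewrite resmZ scalerA -homothetyC -scalerA Vp.
have psi_lin t a p q : V p -> V q ->
    dv x (psi t (a *: p + q) - (a * psi t p + psi t q)).
  move=> _ _; rewrite /psi resmZ evL_lin.
  have := dcoef_linear dec a (evL p t) (evL q t) w; rewrite cw => /dv0P ->.
  exact: dv0.
have psi_fin p : V p -> exists s : seq T, forall t, t \notin s -> dv x (psi t p).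
  move=> _; have [s [_ s0]] := ev_support (sm_incl L p); exists s => t /s0.
  rewrite /psi /evL => ->; have := dcoef0 dec w; rewrite cw => /dv0P ->.
  exact: dv0.
have [B [BV span ind]] := submodule_basis (nd_dvM (nodal_sym xyP))
  (nd_principal (nodal_sym xyP)) V0 V_lin psi_lin psi_fin.
have BP b : B b -> idem w *: b = b by move/BV.
have yV p : V p -> (forall t, dv x (psi t p)) -> hom y *: p = 0.
  move=> Vp H; apply: evL_inj => t; rewrite -{1}Vp /evL linearZ linearZ linear0 ev0 !evZ.
  rewrite epsE ?cwm // homothetyE scalerA.
  have [a E] := H t; rewrite -[co _ _]/(psi t p) E mulrA [y * x]mulrC (nd_mul xyP).
  by rewrite mul0r scale0r.
pose T2 : choiceType := {b : subm L | `[< B b >]}.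
pose phi2 : {linear fs M c (fun _ : T2 => w) -> subm L} :=
  fs_map dec (fun _ : T2 => w) (fun t => val t).
have [j [jE j_surj]] := @fs_incl T2 al w cw.
have jP p : (exists l, j l = p) <-> hom y *: p = 0.
  split=> [[l <-]|yp].
    by apply: fsP => t; rewrite ev_hom jE ev0 -cal (ev_ann l t).
  by apply: j_surj => t; rewrite cal -ev_hom yp ev0.
apply: (@pdi_amalgam _ 0 _ _ _ _ u0 phi2 j);
  [exact: fs_projective dec _ _|exact: fs_projective dec _ _|..|exact: fs_projective dec _ _].
- move=> f g E; apply: fsP => t; have := congr1 (sm_incl L) E.
  by rewrite !u0E => /(congr1 (fun p => ev p t)); rewrite !hE.
- by move=> f g E; apply: fsP => t; rewrite -!jE E.
- suff gen k : rangem (copair u0 phi2) k by move=> k; have [[a p] <-] := gen k; exists a, p.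
  move: k; apply: (@submodule_gen _ (rangem (copair u0 phi2)) w cw).
  + move=> i k ci; have ciy : c i = y by case: (dec_c dec i) ci => [->/eqP//|/cx//|].
    have /u0P[a ua] : hom y *: (idem i *: k) = 0.
      have yv : y *: v i = 0 by rewrite -ciy (dec_cv dec).
      by rewrite scalerA -epsZ ?(dec_cv dec) // yv eps0 scale0r.
    by exists (a, 0); rewrite copairE linear0 addr0.
  + move=> k Vk; have [b [Bb kb]] := span k Vk.
    have Vb : V b.
      case: Bb => s [r [us sB ->]]; rewrite big_seq.
      apply: big_ind => // [u1 u2 V1 V2|b' bs]; first by rewrite -[u1]scale1r; apply: V_lin.
      by rewrite -[_ *: _]addr0; apply: V_lin => //; apply/BV/sB.
    have Vkb : V (k - b) by rewrite addrC -scaleN1r; apply: V_lin.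
    have /u0P[a ua] := yV _ Vkb kb.
    have [p pb] := comb_range cw BP Bb.
    by exists (a, p); rewrite copairE ua pb subrK.
(* By independence of B modulo x, if y kills [phi2 p] it kills p; so the preimage of the image of
   [u0] is again a sum of copies of the projective at al. *)
- move=> p; rewrite jP u0P; split=> [yp|yp]; last by rewrite -linearZ yp linear0.
  apply: fsP => t; rewrite ev_hom ev0 (dcoefE dec (ev p t)) scaler_sumr big1 // => l _.
  have := dec_cv dec l; case: (dec_c dec l) => cl; rewrite cl => clv; first last.
  + by rewrite scalerA mulrC -scalerA clv scaler0.
  + by case: (cx l).
  suff [a ->] : dv x (co (ev p t) l).
    by rewrite scalerA mulrA [y * x]mulrC (nd_mul xyP) mul0r scale0r.
  have [s [r [us sB E tP]]] := phi_coef cw BP p cl.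
  case: (tP t) => [->|[ts <-]].
    by have := dcoef0 dec l; rewrite cl => /dv0P ->; apply: dv0.
  apply: (ind s r us sB) ts => t'.
  rewrite -[X in psi _ X]/(\sum_(b <- s) hom (r b) *: b) -E.
  apply/(nd_ann (nodal_sym xyP))/dv0P; rewrite -{1}cw; apply: dcoef_ann.
  rewrite /evL -ev_hom -linearZ_LR.
  have -> : hom y *: (eps l (v w) *: phi2 p) = 0.
    by rewrite scalerA homothetyC -scalerA yp scaler0.
  by rewrite linear0 ev0.
Qed.

End UpperBounds.

(** * Lower bounds for the global dimension *)

Section LowerBounds.
Variables (R : comNzRingType) (M : lmodType R).
Local Notation S := (endo M).
Implicit Types m : M.

Lemma emod_mul_linear (r : R) : linear (fun m : emod M => r *: (m : M) : emod M).
Proof. by move=> f m m'; rewrite scalerDr !emodZ linearZ. Qed.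
Definition emod_mul (r : R) : {linear emod M -> emod M} := mklin (emod_mul_linear r).
Definition emod_img (r : R) := subm (rangem (emod_mul r)).

Lemma emod_img_surj r : exists g : {linear emod M -> emod_img r},
  (forall m, sm_incl _ (g m) = r *: (m : M)) /\ forall q, exists m, g m = q.
Proof.
have [|g gE] := @corestrict _ _ _ (rangem (emod_mul r)) (emod_mul r).
  by move=> m; exists m.
exists g; split=> // q.
have [m mE] : rangem (emod_mul r) (sm_incl _ q) by apply/sm_inclP; exists q.
by exists m; apply: sm_incl_inj; rewrite gE.
Qed.

(** A retraction r of M onto sM satisfies s r(m) = r(s m) = s m; cancelling s puts every m in sM. *)
Lemma gldim_gt0 (s : R) : (forall m, s *: m = 0 -> m = 0) ->
  (exists m, ~ exists m', m = s *: m') -> ~ gldim_le S 0.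
Proof.
move=> s_inj [m nm] S0.
have [r rK] := gldim_le0_retract S0 (@sm_incl_inj _ _ (rangem (emod_mul s))).
have [g [gE _]] := emod_img_surj s.
have E : r (s *: m : M) = homothety M s *: r m by rewrite -linearZ.
have {}E : s *: (m : M) = s *: (sm_incl _ (r m) : M).
  by rewrite -[RHS]/(homothety M s *: sm_incl _ (r m)) -linearZ_LR -E -gE rK.
have : s *: (m - (sm_incl _ (r m) : M)) = 0 by rewrite scalerBr -E subrr.
move/s_inj/eqP; rewrite subr_eq0 => /eqP mE; apply: nm.
have [m' m'E] : rangem (emod_mul s) (sm_incl _ (r m)) by apply/sm_inclP; exists (r m).
by exists m'; rewrite [LHS]mE -m'E.
Qed.

Variables (n : nat) (v : 'I_n -> M) (c : 'I_n -> R).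

(** Multiplying by x gives x^2 m = 0, hence x m = 0, as y kills x m too; likewise for y. *)
Lemma dec_regular x y : nodal x y -> decomposed x y v c ->
  forall m, (x + y) *: m = 0 -> m = 0.
Proof.
move=> xyP dec m E.
have half x' y' : nodal x' y' -> decomposed x' y' v c -> (x' + y') *: m = 0 -> x' *: m = 0.
  move=> P D /(congr1 (fun m => x' *: m)); rewrite scaler0 scalerA mulrDr (nd_mul P) addr0 => E'.
  apply: (dec_soc0 P D); first by rewrite scalerA.
  by rewrite scalerA [y' * x']mulrC (nd_mul P) scale0r.
apply: (dec_soc0 xyP dec); first exact: half E.
by apply: half (nodal_sym xyP) (decomposed_sym dec) _; rewrite addrC.
Qed.

(** Comparing i-th coordinates modulo [c i] would put 1 in (x, y). *)
Lemma dec_proper x y a b i : nodal x y -> decomposed x y v c ->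
  forall m, v i <> (x * a + y * b) *: m.
Proof.
move=> xyP dec m E.
have H : dv (c i) (1 - (x * a + y * b) * dcoef dec m i).
  have -> : 1 = (i == i)%:R :> R by rewrite eqxx.
  apply: (dcoef_unique dec (r := fun j => (j == i)%:R)
    (s := fun j => (x * a + y * b) * dcoef dec m j)).
  rewrite (bigD1 i) //= eqxx scale1r big1 => [|j /negPf ->]; last by rewrite scale0r.
  rewrite addr0 {1}E {1}(dcoefE dec m) scaler_sumr; apply: eq_bigr => j _.
  by rewrite scalerA.
set d := dcoef dec m i in H.
case: H => s /eqP; rewrite subr_eq => /eqP.
case: (dec_c dec i) => -> E1.
- by apply: (nd_1 xyP (a := a * d) (b := b * d)); rewrite E1; ring.
- by apply: (nd_1 xyP (a := s + a * d) (b := b * d)); rewrite E1; ring.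
- by apply: (nd_1 xyP (a := a * d) (b := s + b * d)); rewrite E1; ring.
Qed.

Lemma gldim_gt0_dec x y (i : 'I_n) : nodal x y -> decomposed x y v c -> ~ gldim_le S 0.
Proof.
move=> xyP dec; apply: (@gldim_gt0 (x + y)); first exact: dec_regular xyP dec.
exists (v i) => -[m E]; apply: (dec_proper (a := 1) (b := 1) xyP dec (m := m)).
by rewrite !mulr1; exact: E.
Qed.

Lemma emod_projective x y w : decomposed x y v c -> c w = 0 -> projective (emod M).
Proof.
move=> dec cw.
pose f (g : fs M c (fun _ : unit => w)) : emod M := ev g tt.
have f_lin : linear f by move=> a g g'; rewrite /f ev_linear.
apply: (@pdi_iso _ 0 _ _ (mklin f_lin)); last exact: fs_projective dec _ _.
  by move=> g g' E; apply: fsP => -[].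
move=> m; exists (delta c (fun _ => w) tt m).
by rewrite mklinE /f ev_delta ?eqxx // cw scale0r.
Qed.

(** A section of M -> xM would send x v_w to some u with x u = x v_w and, since y kills xM, y u = 0.
    The w-th coordinate of u is then x f, so x (x f - 1) = 0 and 1 lies in (x, y). *)
Lemma img_not_projective x y w : nodal x y -> decomposed x y v c -> c w = 0 ->
  ~ projective (emod_img x).
Proof.
move=> xyP dec cw Qp.
have [g [gE g_surj]] := emod_img_surj x.
have [s gs] := Qp _ _ g (idl _) g_surj.
pose q := g (v w); pose u : M := s q.
have xu : x *: u = x *: v w by rewrite -gE gs gE.
have yu : y *: u = 0.
  rewrite -[LHS]/(homothety M y *: (s q : emod M)) -linearZ_LR -linearZ_LR.
  have -> : g (homothety M y *: (v w : emod M)) = 0.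
    apply: sm_incl_inj; rewrite gE linear0 emodZ homothetyE scalerA (nd_mul xyP).
    exact: (scale0r (v w)).
  exact: linear0.
have [f fE] : dv x (dcoef dec u w).
  apply/(nd_ann (nodal_sym xyP))/dv0P; rewrite -{1}cw.
  exact: dcoef_ann.
have /dv0P : dv 0 (x * dcoef dec u w - x * (w == w)%:R).
  rewrite -{1}cw; apply: (dcoef_unique dec (r := fun j => x * dcoef dec u j)
    (s := fun j => x * (j == w)%:R)).
  transitivity (x *: u).
    by rewrite {2}(dcoefE dec u) scaler_sumr; apply: eq_bigr => j _; rewrite scalerA.
  rewrite xu (bigD1 w) //= eqxx mulr1 big1 ?addr0 // => j /negPf ->.
  by rewrite mulr0 scale0r.
rewrite eqxx -[true%:R]/(1 : R) fE -mulrBr => /(nd_ann xyP)[t tE].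
apply: (nd_1 xyP (a := f) (b := - t)).
by rewrite mulrN -tE; ring.
Qed.

Lemma gldim_img x y w d : decomposed x y v c -> c w = 0 -> gldim_le S d.+1 ->
  forall r, pdi d (emod_img r).
Proof.
move=> dec cw Sd r.
exact: gldim_le_syzygy Sd (emod_projective dec cw) (@sm_incl_inj _ _ (rangem (emod_mul r))).
Qed.

(** Without a summand R/x, an element killed by x has all coordinates divisible by y, so the kernel
    of M -> xM is yM. *)
Lemma img_syzygy x y w d : nodal x y -> decomposed x y v c -> c w = 0 ->
  (forall i, c i <> x) -> pdi d.+1 (emod_img x) -> pdi d (emod_img y).
Proof.
move=> xyP dec cw cx; have [g [gE g_surj]] := emod_img_surj x.
apply: (schanuel (i := sm_incl (rangem (emod_mul y))) (g := g));
  first exact: emod_projective dec cw.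
split=> [||m]; [exact: sm_incl_inj|exact: g_surj|].
rewrite -sm_inclP; split=> [gm|[m' <-]].
  have xm : x *: (m : M) = 0 by rewrite -gE gm linear0.
  have /choice[a aE] : forall i, dv y (dcoef dec m i).
    move=> i; have := dcoef_ann dec i xm; case: (dec_c dec i) => ci; rewrite ci.
    - by move/dv0P/(nd_ann xyP).
    - by case: (cx i).
    - exact: nd_dvx.
  exists (\sum_i a i *: v i : M); rewrite mklinE [RHS](dcoefE dec m) scaler_sumr.
  by apply: eq_bigr => i _; rewrite scalerA aE.
apply: sm_incl_inj; rewrite gE linear0 mklinE scalerA (nd_mul xyP).
exact: (scale0r (m' : M)).
Qed.

Lemma gldim_gt1 x y w : nodal x y -> decomposed x y v c -> c w = 0 -> ~ gldim_le S 1.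
Proof.
move=> xyP dec cw /(gldim_img dec cw)/(_ x).
exact: img_not_projective xyP dec cw.
Qed.

Lemma gldim_gt2 x y w : nodal x y -> decomposed x y v c -> c w = 0 ->
  (forall i, c i <> x) -> ~ gldim_le S 2.
Proof.
move=> xyP dec cw cx /(gldim_img dec cw)/(_ x)/(img_syzygy xyP dec cw cx).
exact: img_not_projective (nodal_sym xyP) (decomposed_sym dec) cw.
Qed.

Lemma gldim_infinite x y (w : 'I_n) d : nodal x y -> decomposed x y v c ->
  (forall i, c i = 0) -> ~ gldim_le S d.
Proof.
move=> xyP dec c0; have cw := c0 w.
have [x0 y0 _] := nd_neq0 xyP.
case: d => [|d Sd]; first exact: gldim_gt0_dec w xyP dec.
have H := gldim_img dec cw Sd.
(* The two claims are carried together because xM and yM are syzygies of each other. *)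
have : ~ pdi d (emod_img x) /\ ~ pdi d (emod_img y).
  elim: d {Sd H} => [|d [IHx IHy]].
    split; first exact: img_not_projective xyP dec cw.
    exact: img_not_projective (nodal_sym xyP) (decomposed_sym dec) cw.
  split=> [/(img_syzygy xyP dec cw)H|/(img_syzygy (nodal_sym xyP) (decomposed_sym dec) cw)H].
    by apply/IHy/H => i; rewrite c0 => /esym.
  by apply/IHx/H => i; rewrite c0 => /esym.
by case=> + _; apply.
Qed.

Lemma has_gldim_values x y (w : 'I_n) d : nodal x y -> decomposed x y v c ->
  has_gldim S d -> [\/ d = 1%N, d = 2%N | d = 3%N].
Proof.
move=> xyP dec [Sd Smin].
have d0 : (d != 0)%N.
  by apply/eqP=> d0; apply: (gldim_gt0_dec w xyP dec); rewrite -d0.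
suff : (d <= 3)%N.
  by case: d d0 {Sd Smin} => [|[|[|[|d]]]] //; constructor.
have [[w0 cw]|nw] := pselect (exists w, c w = 0); last first.
  apply: (@leq_trans 1) => //; apply/Smin/(gldim_le1_hereditary xyP dec) => i.
  by apply/eqP=> ci; apply: nw; exists i.
have [[al cal]|nal] := pselect (exists i, c i = y).
  have [[be cbe]|nbe] := pselect (exists i, c i = x).
    by apply: (@leq_trans 2) => //; apply/Smin/(gldim_le2 xyP dec cal cbe cw).
  by apply/Smin/(gldim_le3 xyP dec cal cw) => i ci; apply: nbe; exists i.
have [[be cbe]|nbe] := pselect (exists i, c i = x).
  apply/Smin/(gldim_le3 (nodal_sym xyP) (decomposed_sym dec) cbe cw) => i ci.
  by apply: nal; exists i.
case: (gldim_infinite w xyP dec _ Sd) => i.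
case: (dec_c dec i) => // ci; first by case: nbe; exists i.
by case: nal; exists i.
Qed.

End LowerBounds.

(** * Krull dimension, depth and maximal Cohen-Macaulay modules *)

Section KrullDimension.
Variables (R : comNzRingType).

Lemma prime_power (P : {pred R}) (a : R) k :
  idealr_closed P -> prime_idealr_closed P -> a ^+ k \in P -> a \in P.
Proof.
move=> [_ P1 _] Pp; elim: k => [|k IHk]; first by rewrite expr0 (negPf P1).
by rewrite exprS => /Pp/orP[].
Qed.

(** An element of [p 1] outside [p 0] is no multiple of x, so modulo x it is a unit times a power of
    y. Then y is in [p 1], which already contains the maximal ideal. *)
Lemma chain_le1 x y e p : nodal x y -> prime_chain e p -> (x : R) \in p 0%N -> (e <= 1)%N.
Proof.
move=> xyP [pP p_lt] x0; rewrite leqNgt; apply/negP=> e1.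
have [[p00 p01 p0M] p0p] := pP 0%N isT.
have [p1I p1p] := pP 1%N (ltnW e1).
have [[p20 p21 p2M] _] := pP 2%N e1.
have [p01s p01n] := p_lt 0%N (ltnW e1).
have [p12s p12n] := p_lt 1%N e1.
have [p10 p11 p1M] := p1I.
have idealM P : idealr_closed P -> forall a r : R, r \in P -> a * r \in P.
  by move=> [P0 _ PM] a r rP; rewrite -[a * r]addr0; apply: PM.
have y1 : y \in p 1%N.
  apply: contrapT => ny; apply: p01n => f f1.
  case: (br_dvr (nd_y xyP) f) => [[s ->]|[k [u [w [s [wu fE]]]]]].
    by rewrite mulrC; apply: (idealM _ (pP 0%N isT).1).
  case: ny; apply: (@prime_power _ _ k p1I p1p).
  have -> : y ^+ k = w * f + (- (w * s)) * x.
    transitivity (w * u * y ^+ k); first by rewrite wu mul1r.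
    by rewrite fE; ring.
  rewrite -[w * f]mulrC mulrC; apply: p1M => //.
  by apply: idealM => //; apply: p01s.
apply: p12n => g g2; case: (nd_local xyP g) => [[s sg]|[a [b ->]]].
  by case/negP: p21; rewrite -sg -[s * g]addr0; apply: p2M.
rewrite mulrC; apply: p1M; first exact: p01s.
by rewrite mulrC; apply: idealM.
Qed.

Lemma nodal_krull (x y : R) : nodal x y -> krull_dim R 1.
Proof.
move=> xyP.
pose mm : {pred R} := fun r => `[< exists a b, r = x * a + y * b >].
pose px : {pred R} := fun r => `[< dv x r >].
split.
  exists (fun i => if i == 0%N then px else mm); split=> [[|i] _ /=|i].
  - split; first split.
    + exact/asboolP/dv0.
    + by apply/asboolP=> -[s E]; apply: (nd_1 xyP (a := s) (b := 0)); rewrite mulr0 addr0.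
    + move=> a u w /asboolP xu /asboolP xw; apply/asboolP; apply: dvD xw.
      exact: dvMl.
    move=> u w /asboolP/(nd_dvM (nodal_sym xyP))[] H; apply/orP; [left|right]; exact/asboolP.
  - split; first split.
    + by apply/asboolP; exists 0, 0; rewrite !mulr0 addr0.
    + by apply/asboolP=> -[a [b E]]; apply: (nd_1 xyP (a := a) (b := b)).
    + move=> a u w /asboolP[b [d ->]] /asboolP[b' [d' ->]]; apply/asboolP.
      by exists (a * b + b'), (a * d + d'); ring.
    move=> u w /asboolP[a [b E]]; apply/orP.
    case: (nd_local xyP u) => [[u' u'u]|H]; last by left; apply/asboolP.
    case: (nd_local xyP w) => [[w' w'w]|H]; last by right; apply/asboolP.
    case: (nd_1 xyP (a := u' * w' * a) (b := u' * w' * b)).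
    transitivity ((u' * u) * (w' * w)); first by rewrite u'u w'w mul1r.
    transitivity (u' * w' * (u * w)); first by ring.
    by rewrite E; ring.
  - rewrite ltnS leqn0 => /eqP -> /=; split=> [r /asboolP[s ->]|H].
      by apply/asboolP; exists s, 0; rewrite mulr0 addr0.
    have /asboolP yx : y \in px by apply: H; apply/asboolP; exists 0, 1; rewrite mulr0 add0r mulr1.
    by case: (br_pow (nd_y xyP) (n := 1)); rewrite expr1.
move=> e p ep; have [pP _] := ep.
have [p0I p0p] := pP 0%N isT.
have [p00 _ _] := p0I.
have /orP[xp|yp] : (x \in p 0%N) || (y \in p 0%N) by apply: p0p; rewrite (nd_mul xyP).
  exact: chain_le1 xyP ep xp.
exact: chain_le1 (nodal_sym xyP) ep yp.
Qed.

Lemma krull_dim_unique d e : krull_dim R d -> krull_dim R e -> d = e.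
Proof.
move=> [[p dp] dmax] [[q eq_] emax]; apply/eqP; rewrite eqn_leq.
by rewrite (emax _ _ dp) (dmax _ _ eq_).
Qed.

End KrullDimension.

Section Depth.
Variables (R : comNzRingType) (x y : R) (xyP : nodal x y) (M : lmodType R).
Implicit Types (m : M) (s : seq R).

Lemma ideal_mul_nil m : ideal_mul (M := M) [::] m <-> m = 0.
Proof.
by split=> [[u ->]|->]; [rewrite big_ord0|exists (fun=> 0); rewrite big_ord0].
Qed.

Lemma ideal_mul_one a m : ideal_mul (M := M) [:: a] m <-> exists m', m = a *: m'.
Proof.
split=> [[u ->]|[m' ->]]; first by exists (u 0%N); rewrite big_ord1.
by exists (fun=> m'); rewrite big_ord1.
Qed.

Lemma ideal_mul_head a s m : ideal_mul (a :: s) (a *: m).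
Proof.
exists (fun i => if i is 0%N then m else 0); rewrite big_ord_recl /= big1 ?addr0 //.
by move=> i _; rewrite scaler0.
Qed.

Lemma nonunitP (a : R) : nonunit a -> exists b d, a = x * b + y * d.
Proof. by case: (nd_local xyP a). Qed.

(** A regular nonunit lies in (x, y) and so kills the socle. *)
Lemma depth1_socle d : has_depth M d -> d = 1%N ->
  forall m, x *: m = 0 -> y *: m = 0 -> m = 0.
Proof.
move=> [[s [<- sn [sreg _]]] _]; case: s sn sreg => [//|a [|//]] sn sreg _ m xm ym.
have [|b [b' aE]] := @nonunitP a; first by apply: sn; rewrite inE.
apply/ideal_mul_nil/(sreg 0%N isT)/ideal_mul_nil.
by rewrite /= aE scalerDl [x * b]mulrC [y * b']mulrC -!scalerA xm ym !scaler0 addr0.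
Qed.

(** If y' divides a, then a x' = 0 and regularity gives x' M = 0. Otherwise a = x'^k u + y' t with u
    a unit, and x' a = x'^(k+1) u. *)
Lemma pow_in_image x' y' a : nodal x' y' -> (forall m, a *: m = 0 -> m = 0) ->
  exists k, forall m, exists m', x' ^+ k *: m = a *: m'.
Proof.
move=> P a_inj; case: (br_dvr (nd_x P) a) => [[t aE]|[k [u [w [t [wu aE]]]]]].
  exists 1%N => m; exists 0; rewrite scaler0 expr1; apply: a_inj.
  by rewrite scalerA aE mulrC mulrA (nd_mul P) mul0r scale0r.
exists k.+1 => m; exists ((x' * w) *: m); rewrite scalerA; congr (_ *: _).
transitivity (x' ^+ k.+1 * (w * u) + (x' * y') * (t * w)).
  by rewrite wu (nd_mul P) mul0r addr0 mulr1.
by rewrite aE exprS; ring.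
Qed.

(** If a is regular, some power of any nonunit b maps M into aM; were b regular modulo aM, M would
    equal aM. *)
Lemma regular_size_le1 s : (forall a, a \in s -> nonunit a) -> regular_seq M s ->
  (size s <= 1)%N.
Proof.
case: s => [//|a [//|b s]] sn [sreg [m0 nm0]].
have a_inj m : a *: m = 0 -> m = 0.
  by move=> am; apply/ideal_mul_nil/(sreg 0%N isT)/ideal_mul_nil.
have b_inj m : (exists m', b *: m = a *: m') -> exists m', m = a *: m'.
  by move=> H; apply/ideal_mul_one/(sreg 1%N isT)/ideal_mul_one.
have [k kP] := pow_in_image xyP a_inj.
have [l lP] := pow_in_image (nodal_sym xyP) a_inj.
have [|b1 [b2 bE]] := @nonunitP b; first by apply: sn; rewrite !inE eqxx orbT.
have bpow j : b ^+ j.+1 = x ^+ j.+1 * b1 ^+ j.+1 + y ^+ j.+1 * b2 ^+ j.+1.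
  elim: j => [|j IHj]; first by rewrite !expr1.
  rewrite exprS IHj bE [x ^+ _]exprS [y ^+ _]exprS.
  rewrite [x ^+ j.+2]exprS [y ^+ j.+2]exprS [b1 ^+ j.+2]exprS [b2 ^+ j.+2]exprS.
  rewrite [x ^+ j.+1]exprS [y ^+ j.+1]exprS.
  transitivity (x * (x * x ^+ j) * (b1 * b1 ^+ j.+1) + y * (y * y ^+ j) * (b2 * b2 ^+ j.+1)
    + (x * y) * (b1 * y ^+ j * b2 ^+ j.+1 + b2 * x ^+ j * b1 ^+ j.+1)).
    by ring.
  by rewrite (nd_mul xyP) mul0r addr0.
(* The exponent k + l + 1 is at least k for x and at least l for y. *)
have big m : exists m', b ^+ (k + l).+1 *: m = a *: m'.
  have [m1 E1] := kP ((x ^+ l.+1 * b1 ^+ (k + l).+1) *: m).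
  have [m2 E2] := lP ((y ^+ k.+1 * b2 ^+ (k + l).+1) *: m).
  exists (m1 + m2); rewrite scalerDr -E1 -E2 !scalerA -scalerDl bpow; congr (_ *: _).
  by rewrite !mulrA -!exprD addnS [(l + k.+1)%N]addnS [(l + k)%N]addnC.
have all_image m : exists m', m = a *: m'.
  elim: (k + l).+1 m (big m) => [|j IHj] m [m' E].
    by exists m'; rewrite -E expr0 scale1r.
  by apply/b_inj/IHj; exists m'; rewrite scalerA -exprSr.
by case: nm0; have [m' ->] := all_image m0; apply: ideal_mul_head.
Qed.

Lemma dec_depth n (v : 'I_n -> M) (c : 'I_n -> R) (i : 'I_n) :
  decomposed x y v c -> has_depth M 1.
Proof.
move=> dec; split; last by move=> s sn sreg; apply: regular_size_le1.
exists [:: x + y]; split=> //.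
  move=> a; rewrite inE => /eqP -> [b E].
  by apply: (nd_1 xyP (a := b) (b := b)); rewrite -E; ring.
split=> [j|].
  rewrite ltnS leqn0 => /eqP -> m /=.
  by rewrite !ideal_mul_nil => /(dec_regular xyP dec).
exists (v i); rewrite ideal_mul_one => -[m E].
by apply: (dec_proper (a := 1) (b := 1) xyP dec (m := m)); rewrite !mulr1; exact: E.
Qed.

Lemma dec_maximal_CM n (v : 'I_n -> M) (c : 'I_n -> R) (i : 'I_n) :
  decomposed x y v c -> maximal_CM M.
Proof.
move=> dec; split; last by exists 1%N; [apply: nodal_krull xyP|apply: dec_depth i dec].
by exists n, v; case: dec => -[_ _].
Qed.

Lemma dec_nonzero n (v : 'I_n -> M) (c : 'I_n -> R) (i : 'I_n) :
  decomposed x y v c -> exists m, m <> 0.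
Proof.
move=> dec; exists (v i) => v0.
by apply: (dec_proper (a := 0) (b := 0) (i := i) xyP dec (m := 0)); rewrite scaler0.
Qed.

Lemma maximal_CM_dec : maximal_CM M -> (exists m, m <> 0) ->
  exists n (v : 'I_n -> M) (c : 'I_n -> R), (0 < n)%N /\ decomposed x y v c.
Proof.
move=> [fg [d Rd Md]] [m m0].
have soc0 := depth1_socle Md (krull_dim_unique Rd (nodal_krull xyP)).
have [n [v [c dec]]] := decomposition_exists xyP fg soc0.
exists n, v, c; split=> //; case: n v c dec => // v c dec; case: m0.
by case: dec => -[_ _ /(_ m)[r ->]] _; rewrite big_ord0.
Qed.

End Depth.

Section Models.
Variables (R : comNzRingType) (x y : R) (xyP : nodal x y).
Variables (n : nat) (c : 'I_n -> R).
Hypothesis cP : forall i, c i \in [:: 0; x; y].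

(* R, R/(y) and R/(x) are realized as the annihilators of 0, y and x in R. *)
Lemma model_exists : exists (M : lmodType R) (v : 'I_n -> M), decomposed x y v c.
Proof.
pose V : lmodType R := {ffun 'I_n -> R^o}.
have V0 : forall i, c i * (0 : V) i = 0 by move=> i; rewrite ffunE mulr0.
have V_lin a (u w : V) : (forall i, c i * u i = 0) -> (forall i, c i * w i = 0) ->
    forall i, c i * (a *: u + w) i = 0.
  move=> cu cw i; rewrite !ffunE mulrDr cw addr0.
  by rewrite -[_ *: _]/(a * u i) mulrCA cu mulr0.
pose W := @Submodule R V (fun f => forall i, c i * f i = 0) V0 V_lin.
(* A generator of the annihilator of [c i] in R. *)
pose g i := if c i == 0 then 1 else if c i == y then x else y.
have gP i r : (c i * r = 0 -> exists a, r = a * g i) /\ (r * g i = 0 -> dv (c i) r).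
  have [x0 y0 xy] := nd_neq0 xyP.
  have := cP i; rewrite /g !inE => /or3P[]/eqP ->.
  - rewrite eqxx; split=> [_|]; first by exists r; rewrite mulr1.
    by rewrite mulr1 => ->; apply: dv0.
  - rewrite (negPf (introN eqP x0)) (negPf (introN eqP xy)); split.
      by move/(nd_ann xyP) => [a ->]; exists a; rewrite mulrC.
    by rewrite mulrC => /(nd_ann (nodal_sym xyP)).
  - rewrite (negPf (introN eqP y0)) eqxx; split.
      by move/(nd_ann (nodal_sym xyP)) => [a ->]; exists a; rewrite mulrC.
    by rewrite mulrC => /(nd_ann xyP).
have cg i : c i * g i = 0.
  have [x0 y0 xy] := nd_neq0 xyP.
  have := cP i; rewrite /g !inE => /or3P[]/eqP ->; first by rewrite mul0r.
    by rewrite (negPf (introN eqP x0)) (negPf (introN eqP xy)) (nd_mul xyP).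
  by rewrite (negPf (introN eqP y0)) eqxx mulrC (nd_mul xyP).
pose d i : V := [ffun j => if j == i then g i else 0].
have /choice[v vE] : forall i, exists w : subm W, sm_incl W w = d i.
  move=> i; apply/(sm_inclP W) => j; rewrite ffunE.
  by case: eqP => [->|_]; rewrite ?cg ?mulr0.
have sumE (r : 'I_n -> R) j : sm_incl W (\sum_i r i *: v i) j = r j * g j.
  rewrite linear_sum sum_ffunE (bigD1 j) //= [X in _ + X]big1 => [|i ij].
    by rewrite addr0 -[sm_val _]/(sm_incl W _) vE !ffunE eqxx.
  by rewrite -[sm_val _]/(sm_incl W _) vE !ffunE eq_sym (negPf ij) scaler0.
exists (subm W), v; split; first split=> //.
- move=> i; apply: (@sm_incl_inj _ _ W); apply/ffunP => j.
  rewrite linearZ_LR vE linear0 !ffunE.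
  by case: eqP => _; [exact: cg|rewrite scaler0].
- move=> m; have mW : W (sm_incl W m) by apply/(sm_inclP W); exists m.
  have /choice[r rE] : forall i, exists a, sm_incl W m i = a * g i.
    by move=> i; apply: (gP i _).1; apply: mW.
  by exists r; apply: (@sm_incl_inj _ _ W); apply/ffunP => j; rewrite sumE rE.
- move=> r r0 i; apply: (gP i _).2; rewrite -sumE r0 linear0.
  by rewrite ffunE.
Qed.

End Models.

(** * The ring k[[x,y]]/(xy) *)

Section Node.
Variable k : fieldType.
Implicit Types (f g : series2 k) (b : bool) (r : node k).

Definition node_pi f : node k := \pi_{ideal_quot (@ideal_xy k)}%qT f.

Lemma node_piD f g : node_pi (f + g) = node_pi f + node_pi g.
Proof. exact: (rmorphD (\pi_{ideal_quot (@ideal_xy k)}%qT)). Qed.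
Lemma node_piM f g : node_pi (f * g) = node_pi f * node_pi g.
Proof. exact: (rmorphM (\pi_{ideal_quot (@ideal_xy k)}%qT)). Qed.
Lemma node_pi1 : node_pi 1 = 1.
Proof. exact: (rmorph1 (\pi_{ideal_quot (@ideal_xy k)}%qT)). Qed.
Lemma node_pi0 : node_pi 0 = 0.
Proof. exact: (rmorph0 (\pi_{ideal_quot (@ideal_xy k)}%qT)). Qed.

Lemma node_pi_surj r : exists f, r = node_pi f.
Proof. by exists (repr (r : {ideal_quot (@ideal_xy k)})); rewrite /node_pi reprK. Qed.

(* The restriction of f to the branch y = 0 (b = true) or x = 0 (b = false). *)
Definition axis b f (i : nat) : k := if b then coef f i 0 else coef f 0 i.
Definition axis_var b : series2 k := if b then series2_X k else series2_Y k.

Lemma axisD b f g i : axis b (f + g) i = axis b f i + axis b g i.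
Proof. by case: b. Qed.
Lemma axisN b f i : axis b (- f) i = - axis b f i.
Proof. by case: b. Qed.
Lemma axis_00 b b' f : axis b f 0 = axis b' f 0.
Proof. by case: b b' => -[]. Qed.
Lemma axis1 b i : axis b 1 i = (i == 0%N)%:R.
Proof. by case: b => //=; rewrite /axis /= ?andbT. Qed.
Lemma axisM b f g i :
  axis b (f * g) i = \sum_(a < i.+1) axis b f a * axis b g (i - a).
Proof.
case: b; rewrite /axis /=; last by rewrite big_ord1.
by apply: eq_bigr => a _; rewrite big_ord1.
Qed.

Lemma axis_var_off b i : axis (~~ b) (axis_var b) i = 0.
Proof. by case: b; rewrite /axis /= ?andbF. Qed.
Lemma axis_var_on b i : axis b (axis_var b) i = (i == 1%N)%:R.
Proof. by case: b; rewrite /axis /= ?andbT. Qed.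

Lemma axis_mul_off b f i : axis (~~ b) (axis_var b * f) i = 0.
Proof. by rewrite axisM big1 // => a _; rewrite axis_var_off mul0r. Qed.
Lemma axis_mul_0 b b' f : axis b' (axis_var b * f) 0 = 0.
Proof. by rewrite (axis_00 b' (~~ b)) axis_mul_off. Qed.
Lemma axis_mul_S b f i : axis b (axis_var b * f) i.+1 = axis b f i.
Proof.
rewrite axisM big_ord_recl axis_var_on mul0r add0r big_ord_recl axis_var_on mul1r.
rewrite /= subn1 /= big1 ?addr0 // => a _; rewrite axis_var_on.
by rewrite mul0r.
Qed.

Lemma axis_exp b n f i :
  axis b (axis_var b ^+ n * f) i = if (i < n)%N then 0 else axis b f (i - n).
Proof.
elim: n i => [|n IHn] i; first by rewrite expr0 mul1r subn0.
rewrite exprS -mulrA; case: i => [|i]; first exact: axis_mul_0.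
by rewrite axis_mul_S IHn.
Qed.

(** A series vanishing on both axes is xy times the series with both indices shifted down by one. *)
Lemma node_piP f g : node_pi f = node_pi g <-> forall b i, axis b f i = axis b g i.
Proof.
split=> [/eqP|H].
  rewrite /node_pi -Quotient.idealrBE => /asboolP[h E] b i.
  apply/eqP; rewrite -subr_eq0 -axisN -axisD E mulrC -mulrA; apply/eqP.
  rewrite -[series2_X k]/(axis_var true) -[series2_Y k]/(axis_var false).
  by case: b; [rewrite mulrCA; apply: (axis_mul_off false)|apply: (axis_mul_off true)].
apply/eqP; rewrite /node_pi -Quotient.idealrBE; apply/asboolP.
exists (Series2 (fun i j => coef (f - g) i.+1 j.+1)).
have H0 b i : axis b (f - g) i = 0 by rewrite axisD axisN H subrr.
apply: series2P => i j; rewrite mulrC -mulrA.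
have mulX h i' j' : coef (series2_X k * h) i' j' = if i' is i''.+1 then coef h i'' j' else 0.
  rewrite /=; case: i' => [|i'].
    by rewrite big_ord1 big1 // => d _; rewrite mul0r.
  rewrite big_ord_recl big1 ?add0r => [|d _]; last by rewrite mul0r.
  rewrite big_ord_recl /= big_ord_recl /= mul1r subn0 subn1 /=.
  rewrite big1 ?addr0 => [|d _]; last by rewrite mul0r.
  by rewrite big1 ?addr0 // => d _; rewrite big1 // => e _; rewrite mul0r.
have mulY h i' j' : coef (series2_Y k * h) i' j' = if j' is j''.+1 then coef h i' j'' else 0.
  rewrite /= big_ord_recl /= [X in _ + X]big1 ?addr0; last first.
    by move=> d _; rewrite big1 // => e _; rewrite mul0r.
  case: j' => [|j']; first by rewrite big_ord1 mul0r.
  rewrite big_ord_recl mul0r add0r big_ord_recl /= mul1r subn0 subn1 /=.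
  by rewrite big1 ?addr0 // => d _; rewrite mul0r.
rewrite mulX; case: i => [|i]; first exact: (H0 false).
rewrite mulY; case: j => [|j]; first exact: (H0 true).
by [].
Qed.

Definition axis_series b (u : nat -> k) : series2 k :=
  Series2 (fun i j => if b then (if j == 0%N then u i else 0)
                      else (if i == 0%N then u j else 0)).

Lemma axis_seriesE b u i : axis b (axis_series b u) i = u i.
Proof. by case: b. Qed.

Lemma dv_axis b f : dv (node_pi (axis_var b)) (node_pi f) <-> forall i, axis (~~ b) f i = 0.
Proof.
split=> [[s]|H].
  have [g ->] := node_pi_surj s; rewrite -node_piM => /node_piP E i.
  by rewrite E axis_mul_off.
exists (node_pi (axis_series b (fun i => axis b f i.+1))); rewrite -node_piM.
apply/node_piP => b' i; have [->|/eqP] := eqVneq b' (~~ b).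
  by rewrite axis_mul_off H.
move=> bb'; have -> : b' = b by case: b b' bb' {H} => -[].
case: i => [|i]; first by rewrite axis_mul_0 (axis_00 b (~~ b)).
by rewrite axis_mul_S axis_seriesE.
Qed.

Lemma series_inverse (u : nat -> k) : u 0%N != 0 ->
  exists w : nat -> k, w 0%N = (u 0%N)^-1 /\
    forall i, \sum_(a < i.+1) w a * u (i - a)%N = (i == 0%N)%:R.
Proof.
move=> u0.
pose next n (s : seq k) := (u 0%N)^-1 * ((n == 0%N)%:R - \sum_(a < n) s`_a * u (n - a)%N).
(* Course-of-values recursion: [W n] lists the first n coefficients of the inverse. *)
pose W := fix W n : seq k := if n is m.+1 then rcons (W m) (next m (W m)) else [::].
have sizeW n : size (W n) = n by elim: n => //= n IHn; rewrite size_rcons IHn.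
pose w n := (W n.+1)`_n.
have wE n a : (a < n)%N -> (W n)`_a = w a.
  elim: n => //= n IHn; rewrite ltnS leq_eqVlt nth_rcons sizeW => /orP[/eqP ->|an].
    by rewrite ltnn eqxx /w /= nth_rcons sizeW ltnn eqxx.
  by rewrite an IHn.
have wn n : w n = (u 0%N)^-1 * ((n == 0%N)%:R - \sum_(a < n) w a * u (n - a)%N).
  rewrite {1}/w /= nth_rcons sizeW ltnn eqxx /next; congr (_ * (_ - _)).
  by apply: eq_bigr => a _; rewrite wE.
exists w; split=> [|i]; first by rewrite wn big_ord0 subr0 mulr1.
rewrite big_ord_recr /= subnn wn mulrAC mulVf // mul1r.
by rewrite addrC subrK.
Qed.

(** The inverses of f on the two axes agree at the origin and glue to one series. *)
Lemma node_unit b f : axis b f 0 != 0 -> exists s, s * node_pi f = 1.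
Proof.
move=> f0; have f00 b' : axis b' f 0 != 0 by rewrite (axis_00 b' b).
have [w1 [w10 w1P]] := series_inverse (f00 true).
have [w2 [w20 w2P]] := series_inverse (f00 false).
pose g := Series2 (fun i j => if j == 0%N then w1 i else if i == 0%N then w2 j else 0).
have g1 i : axis true g i = w1 i by [].
have g2 i : axis false g i = w2 i.
  by case: i => //; rewrite /axis /= w10 w20 (axis_00 true false).
exists (node_pi g); rewrite -node_piM -node_pi1; apply/node_piP => -[] i; rewrite axisM axis1.
  by rewrite -w1P; apply: eq_bigr => a _; rewrite g1.
by rewrite -w2P; apply: eq_bigr => a _; rewrite g2.
Qed.

Lemma node_piX b n : node_pi (axis_var b) ^+ n = node_pi (axis_var b ^+ n).
Proof. by elim: n => [|n IHn]; rewrite ?node_pi1 // !exprS IHn node_piM. Qed.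

Lemma node_branch b : branch (node_pi (axis_var b)) (node_pi (axis_var (~~ b))).
Proof.
split=> [r|r|n].
- have [f ->] := node_pi_surj r; rewrite -node_piM -node_pi0 => /node_piP E.
  apply/dv_axis => i; rewrite negbK -axis_mul_S E.
  by case: (b).
- have [f ->] := node_pi_surj r.
  have [exf|nf] := pselect (exists i, axis b f i != 0); last first.
    left; apply/dv_axis => i; rewrite negbK; apply/eqP; apply: contrapT => /negP fi.
    by apply: nf; exists i.
  right; case: (ex_minnP exf) => n fn n_min.
  pose u := axis_series b (fun i => axis b f (n + i)).
  have [|w wu] := @node_unit b u; first by rewrite axis_seriesE addn0.
  have [s sE] : dv (node_pi (axis_var (~~ b))) (node_pi (f - axis_var b ^+ n * u)).
    apply/dv_axis => i; rewrite negbK axisD axisN axis_exp.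
    case: ltnP => [lin|ni]; last by rewrite axis_seriesE subnKC // subrr.
    rewrite subr0; apply/eqP; apply: contrapT => /negP fi.
    by have := n_min i fi; rewrite leqNgt lin.
  exists n, (node_pi u), w, s; split=> //.
  by rewrite node_piX -node_piM -sE -node_piD addrC subrK.
- rewrite node_piX => /dv_axis/(_ n)/eqP; rewrite negbK -[_ ^+ n]mulr1 axis_exp.
  by rewrite ltnn subnn axis1 (oner_eq0 k).
Qed.

Lemma node_nodal : nodal (node_pi (axis_var true)) (node_pi (axis_var false)).
Proof.
split.
- rewrite -node_piM -node_pi0; apply/node_piP => -[] i; last exact: (axis_mul_off true).
  by rewrite mulrC; apply: (axis_mul_off false).
- move=> r; have [f ->] := node_pi_surj r.
  have [f0|/eqP] := eqVneq (axis true f 0) 0; last by move/eqP/node_unit; left.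
  right; exists (node_pi (axis_series true (fun i => axis true f i.+1))).
  exists (node_pi (axis_series false (fun i => axis false f i.+1))).
  rewrite -!node_piM -node_piD; apply/node_piP => b i; rewrite axisD.
  case: i => [|i]; first by rewrite !axis_mul_0 (axis_00 b true) f0 addr0.
  case: b.
    by rewrite axis_mul_S axis_seriesE (axis_mul_off false) addr0.
  by rewrite axis_mul_S axis_seriesE (axis_mul_off true) add0r.
- move=> a b; have [f ->] := node_pi_surj a; have [g ->] := node_pi_surj b.
  rewrite -!node_piM -node_piD -node_pi1 => /node_piP/(_ true 0%N)/eqP.
  by rewrite axis1 axisD !axis_mul_0 addr0 (oner_eq0 k).
- exact: node_branch true.
- exact: node_branch false.
Qed.

End Node.

Theorem proposition4p10 (k : fieldType) :
  global_spectrum (node k) = [set 1%N; 2%N; 3%N]%classic.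
Proof.
have xyP := node_nodal k.
move: (node_pi _) (node_pi _) xyP => y x xyP.
have [x0 y0 xy] := nd_neq0 xyP.
apply/seteqP; split=> [d [M [M0 MCM Sd]]|].
  have [n [v [c [n0 dec]]]] := maximal_CM_dec xyP MCM M0.
  by case: (has_gldim_values (Ordinal n0) xyP dec Sd) => ->; [left; left|left; right|right].
have spec n (c : 'I_n.+1 -> node k) d : (forall i, c i \in [:: 0; x; y]) ->
    (forall (M : lmodType (node k)) (v : 'I_n.+1 -> M), decomposed x y v c ->
       gldim_le (endo M) d /\ forall m, (m < d)%N -> ~ gldim_le (endo M) m) ->
    global_spectrum (node k) d.
  move=> cP H; have [M [v dec]] := model_exists xyP cP.
  have [Sd Slt] := H M v dec.
  exists M; split.
  - exact: (@dec_nonzero _ x y xyP M _ v c ord0 dec).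
  - exact: (@dec_maximal_CM _ x y xyP M _ v c ord0 dec).
  - split=> // m Sm; rewrite leqNgt; apply/negP => /Slt; exact.
(* The values 1, 2 and 3 are realized by R/y, R + R/y + R/x and R + R/y. *)
move=> d [[|]|] /= ->.
- apply: (spec 0%N (fun=> y)) => [i|M v dec]; first by rewrite !inE eqxx !orbT.
  split; first by apply: (gldim_le1_hereditary xyP dec) => _; apply/eqP.
  by case=> // _; apply: (gldim_gt0_dec ord0 xyP dec).
- pose c (i : 'I_3) := [:: 0; y; x]`_i.
  apply: (spec 2%N c) => [i|M v dec].
    by case: i => -[|[|[|]]] //=; rewrite /c /= !inE eqxx ?orbT.
  split; first exact: (gldim_le2 xyP dec (al := 1) (be := 2%:R) (w := 0)).
  case=> [_|[_|//]]; first exact: (gldim_gt0_dec ord0 xyP dec).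
  exact: (gldim_gt1 (w := 0) xyP dec).
- pose c (i : 'I_2) := [:: 0; y]`_i.
  apply: (spec 1%N c) => [i|M v dec].
    by case: i => -[|[|]] //=; rewrite /c /= !inE eqxx ?orbT.
  have cx i : c i <> x by case: i => -[|[|]] //= ?; rewrite /c /= => /esym.
  split; first exact: (gldim_le3 xyP dec (al := 1) (w := 0)).
  case=> [_|[_|[_|//]]]; first exact: (gldim_gt0_dec ord0 xyP dec).
    exact: (gldim_gt1 (w := 0) xyP dec).
  exact: (gldim_gt2 (w := 0) xyP dec).
Qed.
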